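(* Let $d \geq 2$ be an integer and let $\xi_1, \xi_2, \dots$ be i.i.d. random vectors uniformly distributed on the unit Euclidean sphere $S^{d-1}$ in $\mathbb{R}^d$. Let $p \geq 2$. Then for every integer $n \geq 1$ and all functions $f_1, \dots, f_n \in L_p$, $$\mathbb{E}\left\|\sum_{k=1}^n \xi_k f_k\right\|_p^p \leq \mathbb{E}\left|\sum_{k=1}^n \xi_k \|f_k\|_p\right|^p.$$ Moreover, if $d \geq 3$ and $1 \leq p \leq 2$, then the reverse inequality holds: for every integer $n \geq 1$ and all functions $f_1, \dots, f_n \in L_p$, $$\mathbb{E}\left\|\sum_{k=1}^n \xi_k f_k\right\|_p^p \geq \mathbb{E}\left|\sum_{k=1}^n \xi_k \|f_k\|_p\right|^p.$$
   Context: $L_p$ denotes the space of real-valued $p$-integrable functions on $[0,1]$ with Lebesgue measure, with norm $\|f\|_p = \left(\int_0^1 |f(t)|^p\,dt\right)^{1/p}$. $|\cdot|$ denotes the standard Euclidean norm on $\mathbb{R}^d$ and $S^{d-1} = \{x \in \mathbb{R}^d : |x| = 1\}$. For the $\mathbb{R}^d$-valued function $t \mapsto \sum_{k=1}^n \xi_k f_k(t)$, the norm is $\left\|\sum_{k=1}^n \xi_k f_k\right\|_p = \left(\int_0^1 \left|\sum_{k=1}^n f_k(t)\xi_k\right|^p dt\right)^{1/p}$. *)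

(* Defs.v *)
From HB Require Import structures.
From mathcomp Require Import all_boot all_order all_algebra finmap.
From mathcomp Require Import all_classical all_reals all_analysis.

Set Implicit Arguments.
Unset Strict Implicit.
Unset Printing Implicit Defensive.

Import Order.TTheory GRing.Theory Num.Theory.
Import numFieldNormedType.Exports.

Local Open Scope classical_set_scope.
Local Open Scope ring_scope.

(* Row vectors carry the product sigma-algebra (the one the library puts on
   n.-tuple R); over the reals it is the Borel sigma-algebra of R^n. *)
Section measurable_rV.
Context {R : realType} (n : nat).

Let coors : 'I_n -> 'rV[R]_n -> R := fun i x => x ord0 i.

Let rV_set0 : g_sigma_preimage coors set0.
Proof. exact: sigma_algebra0. Qed.

Let rV_setC A : g_sigma_preimage coors A -> g_sigma_preimage coors (~` A).
Proof. exact: sigma_algebraC. Qed.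

Let rV_bigcup (F : (set 'rV[R]_n)^nat) :
  (forall i, g_sigma_preimage coors (F i)) ->
  g_sigma_preimage coors (\bigcup_i (F i)).
Proof. exact: sigma_algebra_bigcup. Qed.

HB.instance Definition _ := @isMeasurable.Build default_measure_display
  'rV[R]_n (g_sigma_preimage coors) rV_set0 rV_setC rV_bigcup.

End measurable_rV.

(* The norm that the library puts on 'rV[R]_d is the sup norm. *)
Definition enorm {R : realType} {d : nat} (x : 'rV[R]_d) : R :=
  Num.sqrt (\sum_(i < d) x ord0 i ^+ 2).

Definition esphere (R : realType) (d : nat) : set 'rV[R]_d :=
  [set x | enorm x = 1].
Arguments esphere : clear implicits.

(* The uniform law on the sphere is the rotation-invariant probability measure
   carried by the sphere, i.e. the normalized surface measure. *)
Definition uniform_on_sphere {R : realType} {d : nat}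
    (nu : set 'rV[R]_d -> \bar R) : Prop :=
  nu (esphere R d) = 1%E /\
  forall O : 'M[R]_d, O *m O^T = 1%:M ->
    forall A : set 'rV[R]_d, measurable A ->
      nu ((fun x => x *m O) @^-1` A) = nu A.

Definition mutually_independent {dO dT : measure_display}
    {Omega : measurableType dO} {T : measurableType dT} {R : realType}
    (P : probability Omega R) (X : nat -> {RV P >-> T}) : Prop :=
  forall (J : {fset nat}) (A : nat -> set T),
    (forall k, measurable (A k)) ->
    P (\bigcap_(k in [set` J]) (X k @^-1` A k)) =
    (\prod_(k <- J) P (X k @^-1` A k))%E.
Arguments mutually_independent {dO dT Omega T R} P X.

Definition lebesgue01 (R : realType) : {measure set (measurableTypeR R) -> \bar R} :=
  mrestr (@lebesgue_measure R) (measurable_itv `[0 : R, 1]).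

(* L_p over [0,1], p finite; an element is represented by a Borel function on R,
   of which only the values on [0,1] matter. *)
Definition Lp01 {R : realType} (p : R) (f : R -> R) : Prop :=
  f \in Lfun (lebesgue01 R) p%:E.

(* [fine] reads off the real value of the norm, which is finite whenever the
   norm is that of (a vector combination of) elements of L_p. *)
Definition Lp01_norm {R : realType} (p : R) (f : R -> R) : R :=
  fine ('N[lebesgue01 R]_(p%:E)[EFin \o f])%E.

Definition Lp01_vnorm {R : realType} {d : nat} (p : R) (F : R -> 'rV[R]_d) : R :=
  Lp01_norm p (fun t => enorm (F t)).

(* Main.v *)
(** The function [moment p b = E |sum_k b_k xi_k|^p] is a positively homogeneous
    function of [u_k = b_k^p >= 0] of degree 1, and the theorem is Jensen's
    inequality for it; so it must be concave in [u] (convex in the reverse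
    case).  By homogeneity this follows once the mixed derivatives of [moment p]
    have a constant sign, i.e. once the derivative [dmoment p k] in [b_k] is
    monotone in the other coordinates.  Spherical means satisfy
    [(a^(d-1) M')' = a^(d-1) E (Delta h)], so that monotonicity holds as soon as
    [Delta (Delta |x|^p)] has a constant sign: it is
    [p (p - 2) (p + d - 2) (p + d - 4) |x|^(p-4)].  The singularity at the origin
    is removed by replacing [|x|^2] by [e + |x|^2].  Rotation invariance enters
    only through an integration by parts formula on the sphere. *)

Require Import Defs.
From mathcomp Require Import all_boot all_order all_algebra finmap.
From mathcomp Require Import all_classical all_reals all_analysis.
From mathcomp Require Import measurable_realfun lebesgue_integral_under.
From mathcomp Require Import ring lra.
From HB Require Import structures.

Set Implicit Arguments.
Unset Strict Implicit.
Unset Printing Implicit Defensive.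

Import Order.TTheory GRing.Theory Num.Theory.
Import numFieldNormedType.Exports.

Local Open Scope classical_set_scope.
Local Open Scope ring_scope.

(** Convexity of [|x|^p] makes [p * dmoment p k] the components of a subgradient of [moment p]; this
    one-sided fact, [moment_tangent], stands in for differentiability. Jensen's inequality is
    applied through a single supporting hyperplane, at the point [a] of the norms:
    [moment (a l) <= sum_k weight k * l k ^ p], where the weights add up to [moment a] by Euler's
    identity. To get it, follow the points with coordinates [a k * min (l k) s] as s grows from 0. A
    coordinate that still moves at time s equals [s * a k], while the others are at most [s * a j].
    Monotonicity therefore bounds its derivative by the one at [s a], which is [s^(p-1)] times the
    one at [a], and [p s^(p-1)] integrates to [l k ^ p]. The path is run in steps of 1/N and the
    rounding errors vanish in the limit. The reverse case turns every comparison around. Finally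
    [l k = |f k t| / a k], and one integrates in t. The dimension enters through [0 <= p + d - 4]:
    for all [p >= 2] this amounts to [d >= 2], for all [p >= 1] to [d >= 3]. *)

Section bounded_expectation.
Context {R : realType} {dO : measure_display} {Omega : measurableType dO}.
Variable P : probability Omega R.
Implicit Types f g : Omega -> R.

(** The bound is asked at every point, so that integrability follows from closure properties alone.
    For this reason the random vectors are later put on the sphere everywhere ([sph]), not just
    almost surely. *)
Definition bddm f := measurable_fun setT f /\ exists C, forall w, `|f w| <= C.

Lemma bddm_cst c : bddm (fun _ => c).
Proof. by split; [exact: measurable_cst | exists `|c|]. Qed.

Lemma bddmD f g : bddm f -> bddm g -> bddm (fun w => f w + g w).
Proof.
move=> [mf [C fC]] [mg [D gD]]; split; first exact: measurable_funD.
by exists (C + D) => w; apply: (le_trans (ler_normD _ _)); exact: lerD.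
Qed.

Lemma bddmM f g : bddm f -> bddm g -> bddm (fun w => f w * g w).
Proof.
move=> [mf [C fC]] [mg [D gD]]; split; first exact: measurable_funM.
by exists (C * D) => w; rewrite normrM ler_pM.
Qed.

Lemma bddmZ c f : bddm f -> bddm (fun w => c * f w).
Proof. by move=> bf; apply: bddmM => //; exact: bddm_cst. Qed.

Lemma bddmN f : bddm f -> bddm (fun w => - f w).
Proof.
by move=> [mf [C fC]]; split; [exact: measurable_funN | exists C => w; rewrite normrN].
Qed.

Lemma bddmB f g : bddm f -> bddm g -> bddm (fun w => f w - g w).
Proof. by move=> bf bg; apply: bddmD => //; exact: bddmN. Qed.

Lemma bddmX f n : bddm f -> bddm (fun w => f w ^+ n).
Proof.
move=> bf; elim: n => [|n ih]; first exact: bddm_cst.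
by under eq_fun do rewrite exprS; exact: bddmM.
Qed.

Lemma bddm_sum (I : Type) (r : seq I) (Q : pred I) (F : I -> Omega -> R) :
  (forall i, bddm (F i)) -> bddm (fun w => \sum_(i <- r | Q i) F i w).
Proof.
move=> bF; elim: r => [|i r ih].
  by under eq_fun do rewrite big_nil; exact: bddm_cst.
under eq_fun do rewrite big_cons; case: (Q i) => //.
exact: bddmD.
Qed.

Lemma bddm_integrable f : bddm f -> P.-integrable setT (EFin \o f).
Proof.
move=> [mf [C fC]]; apply: measurable_bounded_integrable => //.
  by rewrite (le_lt_trans (probability_le1 P measurableT))// ltry.
exists C; split; first exact: num_real.
by move=> x Cx w _ /=; exact: le_trans (fC w) (ltW Cx).
Qed.

Definition Ex f := \int[P]_w f w.

Lemma Ex_cst c : Ex (fun _ => c) = c.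
Proof.
rewrite /Ex Rintegral_cst// -[RHS]mulr1; congr (_ * _).
by rewrite [X in fine X](probability_setT P).
Qed.

Lemma ExD f g : bddm f -> bddm g -> Ex (fun w => f w + g w) = Ex f + Ex g.
Proof. by move=> bf bg; apply: RintegralD => //; exact: bddm_integrable. Qed.

Lemma ExB f g : bddm f -> bddm g -> Ex (fun w => f w - g w) = Ex f - Ex g.
Proof. by move=> bf bg; apply: RintegralB => //; exact: bddm_integrable. Qed.

Lemma ExZ c f : bddm f -> Ex (fun w => c * f w) = c * Ex f.
Proof. by move=> bf; apply: RintegralZl => //; exact: bddm_integrable. Qed.

Lemma ExN f : bddm f -> Ex (fun w => - f w) = - Ex f.
Proof.
move=> bf; rewrite -mulN1r -ExZ//.
by congr Ex; apply/funext => w; rewrite mulN1r.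
Qed.

Lemma le_Ex f g : bddm f -> bddm g -> (forall w, f w <= g w) -> Ex f <= Ex g.
Proof. by move=> bf bg fg; apply: le_Rintegral => //; exact: bddm_integrable. Qed.

Lemma Ex_ge0 f : (forall w, 0 <= f w) -> 0 <= Ex f.
Proof. by move=> f0; exact: Rintegral_ge0. Qed.

Lemma Ex_sum (I : Type) (r : seq I) (Q : pred I) (F : I -> Omega -> R) :
  (forall i, bddm (F i)) ->
  Ex (fun w => \sum_(i <- r | Q i) F i w) = \sum_(i <- r | Q i) Ex (F i).
Proof.
move=> bF; elim: r => [|i r ih].
  by under eq_fun do rewrite big_nil; rewrite Ex_cst big_nil.
under eq_fun do rewrite big_cons; rewrite big_cons; case: (Q i) => //.
by rewrite ExD ?ih//; exact: bddm_sum.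
Qed.

Lemma Ex_derive (F F' : R -> Omega -> R) (C a : R) :
  (forall x w, `|x - a| < 1 -> is_derive x 1 (F^~ w) (F' x w)) ->
  (forall x, bddm (F x)) ->
  (forall x w, `|x - a| < 1 -> `|F' x w| <= C) ->
  is_derive a 1 (fun x => Ex (F x)) (Ex (F' a)).
Proof.
move=> dF bF bF'.
have Ia : [set` `]a - 1, a + 1[] a by rewrite /= in_itv/= ltrBlDr ltrDl ltr01.
have nI x : [set` `]a - 1, a + 1[] x -> `|x - a| < 1.
  by rewrite /= in_itv/= ltr_norml => /andP[? ?]; apply/andP; split; lra.
have iF x : [set` `]a - 1, a + 1[] x -> P.-integrable setT (EFin \o F x).
  by move=> _; exact: bddm_integrable.
have dvF x w : [set` `]a - 1, a + 1[] x -> setT w -> derivable (F^~ w) x 1.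
  by move=> /nI Ix _; have [] := dF _ w Ix.
have E x w : `|x - a| < 1 -> (partial1of2 F) x w = F' x w.
  by move=> /dF Ix; rewrite partial1of2E; have [_ ] := Ix w.
have C0 w : 0 <= (fun _ : Omega => C) w.
  by apply: le_trans (bF' a w _) => //; rewrite subrr normr0.
have iC : P.-integrable setT (EFin \o (fun _ : Omega => C)).
  by apply: bddm_integrable; exact: bddm_cst.
have ub x w : [set` `]a - 1, a + 1[] x -> setT w -> `|(partial1of2 F) x w| <= C.
  by move=> /nI Ix _; rewrite E//; exact: bF'.
apply: DeriveDef.
  exact: (derivable_under_integral measurableT Ia iF dvF C0 iC ub).
rewrite -derive1E (differentiation_under_integral measurableT Ia iF dvF C0 iC ub).
by apply: eq_Rintegral => w _; rewrite E// subrr normr0.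
Qed.

End bounded_expectation.

(** * Radial profiles and one-variable derivatives *)

Section locally_bounded.
Context {R : realType}.
Implicit Types g : R -> R.

(** The class of radial profiles: they are applied to the squared length of a bounded vector, so a
    bound on each [[0, M]] makes the composite [bddm]. *)
Definition nice g := measurable_fun setT g /\
  forall M, exists C, forall s, 0 <= s <= M -> `|g s| <= C.

Lemma bddm_nice dO (Omega : measurableType dO) g (s : Omega -> R) :
  nice g -> bddm s -> (forall w, 0 <= s w) -> bddm (fun w => g (s w)).
Proof.
move=> [mg gC] [ms [M sM]] s0; split; first exact: measurableT_comp.
have [C hC] := gC M; exists C => w; apply: hC.
by rewrite s0 (le_trans _ (sM w))// ler_norm.
Qed.
End locally_bounded.

Section eta_derivatives.
Context {R : realType}.
Implicit Types f g : R -> R.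

Lemma der1_id (x : R) : is_derive x 1 (fun t => t : R) 1.
Proof. exact: is_derive_id. Qed.

Lemma der1_cst (c x : R) : is_derive x 1 (fun _ => c : R) 0.
Proof. exact: is_derive_cst. Qed.

Lemma der1_add f g (x df dg : R) : is_derive x 1 f df -> is_derive x 1 g dg ->
  is_derive x 1 (fun t => f t + g t) (df + dg).
Proof. by move=> hf hg; exact: is_deriveD. Qed.

Lemma der1_sub f g (x df dg : R) : is_derive x 1 f df -> is_derive x 1 g dg ->
  is_derive x 1 (fun t => f t - g t) (df - dg).
Proof. by move=> hf hg; exact: is_deriveB. Qed.

Lemma der1_mul f g (x df dg : R) : is_derive x 1 f df -> is_derive x 1 g dg ->
  is_derive x 1 (fun t => f t * g t) (f x * dg + g x * df).
Proof. by move=> hf hg; exact: is_deriveM. Qed.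

Lemma der1_exp f (x df : R) n : is_derive x 1 f df ->
  is_derive x 1 (fun t => f t ^+ n) (n%:R * f x ^+ n.-1 * df).
Proof.
move=> hf; have -> : (fun t => f t ^+ n) = (f ^+ n).
  by apply/funext => t; rewrite fctE.
exact: is_deriveX.
Qed.

Lemma der1_comp f g (x df dg : R) : is_derive (g x) 1 f df -> is_derive x 1 g dg ->
  is_derive x 1 (fun t => f (g t)) (df * dg).
Proof. by move=> hf hg; exact: is_derive1_comp. Qed.

Lemma der1_eq f (x df df' : R) :
  is_derive x 1 f df -> df = df' -> is_derive x 1 f df'.
Proof. by move=> hf <-. Qed.

End eta_derivatives.

(** * Euclidean geometry of row vectors and planar rotations *)

Section vectors.
Context {R : realType} {d : nat}.
Implicit Types x y z : 'rV[R]_d.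

Definition dotv x y := \sum_(i < d) x ord0 i * y ord0 i.
Definition nsq x := \sum_(i < d) x ord0 i ^+ 2.

Lemma nsq_ge0 x : 0 <= nsq x.
Proof. by apply: sumr_ge0 => i _; exact: sqr_ge0. Qed.

Lemma nsq_dot x : nsq x = dotv x x.
Proof. by apply: eq_bigr => i _; rewrite expr2. Qed.

Lemma dotvC x y : dotv x y = dotv y x.
Proof. by apply: eq_bigr => i _; rewrite mulrC. Qed.

Lemma dotvDl x y z : dotv (x + y) z = dotv x z + dotv y z.
Proof. by rewrite -big_split; apply: eq_bigr => i _; rewrite mxE mulrDl. Qed.

Lemma dotvZl a x y : dotv (a *: x) y = a * dotv x y.
Proof. by rewrite mulr_sumr; apply: eq_bigr => i _; rewrite mxE mulrA. Qed.

Lemma dotvDr x y z : dotv x (y + z) = dotv x y + dotv x z.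
Proof. by rewrite dotvC dotvDl !(dotvC x). Qed.

Lemma dotvZr a x y : dotv x (a *: y) = a * dotv x y.
Proof. by rewrite dotvC dotvZl dotvC. Qed.

Lemma dotv_suml (I : Type) (r : seq I) (Q : pred I) (F : I -> 'rV[R]_d) y :
  dotv (\sum_(i <- r | Q i) F i) y = \sum_(i <- r | Q i) dotv (F i) y.
Proof.
apply: (big_morph (fun x => dotv x y)) => [x z|]; first exact: dotvDl.
by apply: big1 => i _; rewrite mxE mul0r.
Qed.

Lemma nsqDZ x a y : nsq (x + a *: y) = nsq x + a ^+ 2 * nsq y + 2 * a * dotv x y.
Proof.
rewrite !nsq_dot !dotvDl !dotvDr !dotvZl !dotvZr (dotvC y x); ring.
Qed.

Lemma nsqZ a x : nsq (a *: x) = a ^+ 2 * nsq x.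
Proof. by rewrite !nsq_dot dotvZl dotvZr mulrA expr2. Qed.

Lemma cauchy_schwarz x y : dotv x y ^+ 2 <= nsq x * nsq y.
Proof.
have [y0|y0] := eqVneq (nsq y) 0.
  suff -> : dotv x y = 0 by rewrite expr0n/= y0 mulr0.
  move/eqP: y0; rewrite psumr_eq0; last by move=> i _; exact: sqr_ge0.
  move/allP => y0; apply: big1 => i _.
  by have /implyP/(_ isT) := y0 i (mem_index_enum _); rewrite sqrf_eq0 => /eqP ->; rewrite mulr0.
have yp : 0 < nsq y by rewrite lt_neqAle eq_sym y0 nsq_ge0.
have := nsq_ge0 (x + (- (dotv x y / nsq y)) *: y).
rewrite nsqDZ -(pmulr_rge0 _ yp).
have -> : nsq y * (nsq x + (- (dotv x y / nsq y)) ^+ 2 * nsq y +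
  2 * - (dotv x y / nsq y) * dotv x y) = nsq x * nsq y - dotv x y ^+ 2 by field.
by rewrite subr_ge0.
Qed.

Lemma dotv_orth (O : 'M[R]_d) x y : O *m O^T = 1%:M ->
  dotv (x *m O) (y *m O) = dotv x y.
Proof.
move=> OO; have dE u v : dotv u v = (u *m v^T) ord0 ord0.
  by rewrite mxE; apply: eq_bigr => i _; rewrite mxE.
by rewrite !dE trmx_mul mulmxA -(mulmxA x) OO mulmx1.
Qed.

Lemma nsq_orth (O : 'M[R]_d) x : O *m O^T = 1%:M -> nsq (x *m O) = nsq x.
Proof. by move=> OO; rewrite !nsq_dot dotv_orth. Qed.

Definition planar_rot (i j : 'I_d) (c s : R) : 'M[R]_d :=
  1%:M + (c - 1) *: (delta_mx i i + delta_mx j j) +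
  s *: (delta_mx i j - delta_mx j i).

(** The projection [A] onto the plane and the quarter turn [B] in it multiply like 1 and the
    imaginary unit, and [B] is skew; the claim is then that [c + i s] has modulus 1. *)
Lemma planar_rot_orth i j c s : i != j -> c ^+ 2 + s ^+ 2 = 1 ->
  planar_rot i j c s *m (planar_rot i j c s)^T = 1%:M.
Proof.
move=> ij cs; rewrite /planar_rot.
set A := delta_mx i i + _; set B := delta_mx i j - _.
have At : A^T = A by rewrite linearD/= !trmx_delta.
have Bt : B^T = - B by rewrite linearB/= !trmx_delta opprB.
have ji : j != i by rewrite eq_sym.
have mm (a b e f : 'I_d) : delta_mx a b *m delta_mx e f =
  (b == e)%:R *: delta_mx a f :> 'M[R]_d.
  by rewrite mul_delta_mx_cond; case: (b == e); rewrite ?scale1r ?scale0r.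
have AA : A *m A = A.
  rewrite !mulmxDl !mulmxDr !mm !eqxx (negPf ij) (negPf ji).
  by rewrite !scale1r !scale0r addr0 add0r.
have AB : A *m B = B.
  rewrite !mulmxDl !mulmxDr !mulmxN !mm !eqxx (negPf ij) (negPf ji).
  by rewrite !scale1r !scale0r subr0 add0r.
have BA : B *m A = B.
  rewrite !mulmxDl !mulmxDr !mulNmx !mm !eqxx (negPf ij) (negPf ji).
  by rewrite !scale1r !scale0r add0r subr0.
have BB : B *m B = - A.
  rewrite !mulmxDl !mulmxDr !mulNmx !mulmxN !mm !eqxx (negPf ij) (negPf ji).
  by rewrite !scale1r !scale0r opprK addr0 add0r opprD.
clearbody A B.
rewrite !linearD/= !linearZ/= At Bt trmx1.
rewrite mulmx1 !mulmxN !mulmxDl !mul1mx -!scalemxAl.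
rewrite AA AB BA BB.
apply/matrixP => a b; rewrite !mxE.
have c2 : c ^+ 2 = 1 - s ^+ 2 by rewrite -cs addrK.
by ring: c2.
Qed.

Lemma planar_rotE i j c s x k : (x *m planar_rot i j c s) ord0 k =
  x ord0 k + (c - 1) * (x ord0 i * (k == i)%:R + x ord0 j * (k == j)%:R) +
  s * (x ord0 i * (k == j)%:R - x ord0 j * (k == i)%:R).
Proof.
have dE a b : (x *m delta_mx a b) ord0 k = x ord0 a * (k == b)%:R.
  rewrite mxE (bigD1 a)//= big1 => [|e ea]; rewrite mxE ?eqxx ?addr0//.
  by rewrite (negPf ea) mulr0.
rewrite !mulmxDr mulmx1 -!scalemxAr !mulmxDr mulmxN.
by rewrite -!dE !mxE.
Qed.

End vectors.

(** * Random vectors and rotation invariance *)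

Section coordinates.
Context {R : realType} {d : nat}.

Lemma measurable_coord (i : 'I_d) :
  measurable_fun setT (fun x : 'rV[R]_d => x ord0 i).
Proof.
move=> _ Y mY; rewrite setTI; apply: sub_sigma_algebra => /=.
rewrite -bigcup_seq/=; exists i => /=; first by rewrite mem_index_enum.
by exists Y => //; rewrite setTI.
Qed.

Context {dO : measure_display} {Omega : measurableType dO}.
Implicit Types W X : Omega -> 'rV[R]_d.

Lemma measurable_rVP W : (forall i, measurable_fun setT (fun w => W w ord0 i)) ->
  measurable_fun setT W.
Proof.
move=> mW; suff : forall A, measurable A -> measurable (W @^-1` A).
  by move=> h _ A mA; rewrite setTI; exact: h.
move=> A mA; suff : <<s \big[setU/set0]_(i < d)
    preimage_set_system setT (fun x : 'rV[R]_d => x ord0 i) measurable >> `<=`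
    [set A | measurable (W @^-1` A)] by apply.
apply: smallest_sub.
  split => /=; first by rewrite preimage_set0.
  - by move=> B mB; rewrite setTD preimage_setC; exact: measurableC.
  - by move=> F mF; rewrite preimage_bigcup; exact: bigcup_measurable.
rewrite -bigcup_seq/=; apply: bigcup_sub => i _ B [C mC <-] /=.
rewrite setTI; have := mW i measurableT C mC; rewrite setTI; exact.
Qed.

Lemma measurable_dotv W X :
  (forall i, measurable_fun setT (fun w => W w ord0 i)) ->
  (forall i, measurable_fun setT (fun w => X w ord0 i)) ->
  measurable_fun setT (fun w => dotv (W w) (X w)).
Proof.
by move=> mW mX; apply: measurable_sum => i; exact: measurable_funM.
Qed.

Lemma measurable_nsq W :
  (forall i, measurable_fun setT (fun w => W w ord0 i)) ->
  measurable_fun setT (fun w => nsq (W w)).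
Proof. by move=> mW; apply: measurable_sum => i; exact: measurable_funX. Qed.

Definition bddv W := forall i, bddm (fun w => W w ord0 i).

Lemma bddvD W X : bddv W -> bddv X -> bddv (fun w => W w + X w).
Proof. by move=> bW bX i; under eq_fun do rewrite mxE; exact: bddmD. Qed.

Lemma bddvZ a W : bddv W -> bddv (fun w => a *: W w).
Proof. by move=> bW i; under eq_fun do rewrite mxE; exact: bddmZ. Qed.

Lemma bddv_sum (I : Type) (r : seq I) (Q : pred I) (F : I -> Omega -> 'rV[R]_d) :
  (forall i, bddv (F i)) -> bddv (fun w => \sum_(i <- r | Q i) F i w).
Proof.
by move=> bF i; under eq_fun do rewrite summxE; apply: bddm_sum => j; exact: bF.
Qed.

Lemma bddm_dotv W X : bddv W -> bddv X -> bddm (fun w => dotv (W w) (X w)).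
Proof. by move=> bW bX; apply: bddm_sum => i; exact: bddmM. Qed.

Lemma bddm_nsq W : bddv W -> bddm (fun w => nsq (W w)).
Proof. by move=> bW; apply: bddm_sum => i; exact: bddmX. Qed.

(* The law of [X] is rotation invariant conditionally on [W]. *)
Definition rotinv (P : probability Omega R) W X :=
  forall O : 'M[R]_d, O *m O^T = 1%:M ->
  forall psi : 'rV[R]_d * 'rV[R]_d -> R, measurable_fun setT psi ->
    bddm (fun w => psi (W w, X w)) -> bddm (fun w => psi (W w, X w *m O)) ->
    Ex P (fun w => psi (W w, X w)) = Ex P (fun w => psi (W w, X w *m O)).

End coordinates.

(** * Integration by parts on the sphere *)

Section stein.
Context {R : realType} {d : nat} {dO : measure_display} {Omega : measurableType dO}.
Variable P : probability Omega R.
Variables W X : Omega -> 'rV[R]_d.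
Hypotheses (bW : bddv W) (bX : bddv X) (X1 : forall w, nsq (X w) = 1).
Hypothesis rotX : rotinv P W X.

Lemma dotv_planar_rot (i j : 'I_d) c s (x y : 'rV[R]_d) :
  dotv x (y *m planar_rot i j c s) = dotv x y +
  (c - 1) * (x ord0 i * y ord0 i + x ord0 j * y ord0 j) +
  s * (x ord0 j * y ord0 i - x ord0 i * y ord0 j).
Proof.
have sumE (F : 'I_d -> R) k : \sum_l F l * (l == k)%:R = F k.
  by rewrite (bigD1 k)//= big1 ?eqxx ?mulr1 ?addr0// => l /negPf ->; rewrite mulr0.
rewrite /dotv -[x ord0 i * y ord0 i](sumE (fun l => x ord0 l * y ord0 i)).
rewrite -[x ord0 j * y ord0 j](sumE (fun l => x ord0 l * y ord0 j)).
rewrite -[x ord0 i * y ord0 j](sumE (fun l => x ord0 l * y ord0 j)).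
rewrite -[x ord0 j * y ord0 i](sumE (fun l => x ord0 l * y ord0 i)).
rewrite -sumrB -!big_split/= !mulr_sumr -!big_split/=.
by apply: eq_bigr => k _; rewrite planar_rotE; ring.
Qed.

(* The derivative at angle 0 of the constant E[(w_j x_i - w_i x_j) phi(|w + a x|^2)],
   [x] being rotated in the plane of the coordinates [i] and [j]. *)
Lemma stein_plane (i j : 'I_d) (a : R) (phi dphi : R -> R) : i != j ->
  nice phi -> nice dphi -> (forall s : R, 0 <= s -> is_derive s 1 phi (dphi s)) ->
  Ex P (fun w => (W w ord0 i * X w ord0 i + W w ord0 j * X w ord0 j) *
                 phi (nsq (W w + a *: X w))) =
  Ex P (fun w => 2 * a * (W w ord0 j * X w ord0 i - W w ord0 i * X w ord0 j) ^+ 2 *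
                 dphi (nsq (W w + a *: X w))).
Proof.
move=> ij nphi ndphi dphiE.
(* [r] is the part of the inner product of [W] and [X] carried by the plane, and [q] is the
   derivative of that inner product at angle 0. Rotating [X] by the angle [t] changes [q] into
   [cos t * q - sin t * r]. *)
pose r w := W w ord0 i * X w ord0 i + W w ord0 j * X w ord0 j.
pose q w := W w ord0 j * X w ord0 i - W w ord0 i * X w ord0 j.
pose s0 w := nsq (W w + a *: X w).
pose s t w := s0 w + 2 * a * ((cos t - 1) * r w + sin t * q w).
have bq : bddm q by apply: bddmB; apply: bddmM.
have br : bddm r by apply: bddmD; apply: bddmM.
have bs0 : bddm s0 by apply: bddm_nsq; apply: bddvD => //; exact: bddvZ.
pose O t := planar_rot i j (cos t) (sin t : R).
have OO t : O t *m (O t)^T = 1%:M by apply: planar_rot_orth => //; exact: cos2Dsin2.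
have sE t w : nsq (W w + a *: (X w *m O t)) = s t w.
  by rewrite /s /s0 !nsqDZ nsq_orth// dotv_planar_rot /r /q; ring.
have s_ge0 t w : 0 <= s t w by rewrite -sE nsq_ge0.
have bs t : bddm (s t).
  by apply: bddmD => //; apply: bddmZ; apply: bddmD; exact: bddmZ.
pose F (t : R) w := (cos t * q w - sin t * r w) * phi (s t w).
pose F' t w := (cos t * q w - sin t * r w) *
   (dphi (s t w) * (2 * a * (- sin t * r w + cos t * q w))) +
   phi (s t w) * (- sin t * q w - cos t * r w).
have bF t : bddm (F t).
  by apply: bddmM; [apply: bddmB; exact: bddmZ | exact: bddm_nice].
have dF (t : R) w : is_derive t 1 (F^~ w) (F' t w).
  have dc (c : R) : is_derive t 1 (fun t => cos t * c) (- sin t * c).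
    apply: (der1_eq (der1_mul (is_derive_cos t) (der1_cst c t))).
    ring.
  have ds (c : R) : is_derive t 1 (fun t => sin t * c) (cos t * c).
    apply: (der1_eq (der1_mul (is_derive_sin t) (der1_cst c t))).
    ring.
  have dcr := der1_mul (der1_sub (is_derive_cos t) (der1_cst 1 t)) (der1_cst (r w) t).
  have dst : is_derive t 1 (s^~ w) (2 * a * (- sin t * r w + cos t * q w)).
    apply: (der1_eq (der1_add (der1_cst (s0 w) t)
      (der1_mul (der1_cst (2 * a) t) (der1_add dcr (ds (q w)))))).
    ring.
  apply: (der1_eq (der1_mul (der1_sub (dc (q w)) (ds (r w)))
    (@der1_comp _ phi (s^~ w) _ _ _ (dphiE _ (s_ge0 t w)) dst))).
  rewrite /F'; ring.
have [_ [Q hQ]] := bq; have [_ [K hK]] := br; have [_ [S hS]] := bs0.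
have hs t w : 0 <= s t w <= S + 2 * `|a| * (2 * K + Q).
  rewrite s_ge0/= /s; apply: lerD; first exact: le_trans (ler_norm _) (hS w).
  apply: (le_trans (ler_norm _)); rewrite normrM normrM (ger0_norm (ltW _))//.
  apply: ler_wpM2l; first by rewrite mulr_ge0.
  apply: (le_trans (ler_normD _ _)); rewrite !normrM; apply: lerD.
    apply: ler_pM => //; apply: (le_trans (ler_normB _ _)).
    by rewrite normr1 -[leRHS]/(1 + 1) lerD2r cos_max.
  by rewrite -[leRHS]mul1r; apply: ler_pM => //; exact: sin_max.
have [C1 hC1] := nphi.2 (S + 2 * `|a| * (2 * K + Q)).
have [C2 hC2] := ndphi.2 (S + 2 * `|a| * (2 * K + Q)).
have trig (u v x y : R) A B : `|u| <= 1 -> `|v| <= 1 -> `|x| <= A -> `|y| <= B ->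
    `|u * x + v * y| <= A + B.
  move=> u1 v1 xA yB; apply: (le_trans (ler_normD _ _)); rewrite !normrM.
  by apply: lerD; rewrite -[leRHS]mul1r; apply: ler_pM.
have hF' t w : `|t - 0| < 1 ->
    `|F' t w| <= (Q + K) * (C2 * (`|2 * a| * (K + Q))) + C1 * (Q + K).
  move=> _; have c1 := cos_max t; have s1 := sin_max t.
  have s1' : `|- sin t| <= 1 by rewrite normrN.
  have c1' : `|- cos t| <= 1 by rewrite normrN.
  apply: (le_trans (ler_normD _ _)); rewrite 5!normrM -!mulNr; apply: lerD.
    apply: ler_pM; rewrite ?mulr_ge0//; first exact: trig.
    apply: ler_pM; rewrite ?mulr_ge0//; first exact: hC2.
    by rewrite -normrM ler_wpM2l//; exact: trig.
  by apply: ler_pM => //; [exact: hC1 | exact: trig].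
have D0 := Ex_derive P (fun t w _ => dF t w) bF hF'.
have cstF t : Ex P (F t) = Ex P (F 0).
  pose psi (z : 'rV[R]_d * 'rV[R]_d) :=
    (z.1 ord0 j * z.2 ord0 i - z.1 ord0 i * z.2 ord0 j) * phi (nsq (z.1 + a *: z.2)).
  have psiE t' w : psi (W w, X w *m O t') = F t' w.
    rewrite /psi /F /= sE; congr (_ * _).
    rewrite !planar_rotE !eqxx (negPf ij) [j == i]eq_sym (negPf ij) /q /r /=.
    ring.
  have O0 : O 0 = 1%:M by rewrite /O /planar_rot cos0 sin0 subrr !scale0r !addr0.
  have psiE0 w : psi (W w, X w) = F 0 w by rewrite -psiE O0 mulmx1.
  have m1 k : measurable_fun setT (fun z : 'rV[R]_d * 'rV[R]_d => z.1 ord0 k).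
    exact: (measurableT_comp (measurable_coord k) measurable_fst).
  have m2 k : measurable_fun setT (fun z : 'rV[R]_d * 'rV[R]_d => z.2 ord0 k).
    exact: (measurableT_comp (measurable_coord k) measurable_snd).
  have mpsi : measurable_fun setT psi.
    apply: measurable_funM.
      by apply: measurable_funB; apply: measurable_funM.
    apply: measurableT_comp; first exact: nphi.1.
    apply: measurable_nsq => k; under eq_fun do rewrite !mxE.
    by apply: measurable_funD => //; apply: measurable_funM.
  have e0 : (fun w => psi (W w, X w)) = F 0 by apply/funext.
  have et : (fun w => psi (W w, X w *m O t)) = F t by apply/funext.
  by have := rotX (OO t) mpsi; rewrite e0 et => ->.
have : Ex P (F' 0) = 0.
  have [_ <-] := D0.
  under eq_fun do rewrite cstF.
  exact: derive_cst.
have s00 w : s 0 w = s0 w by rewrite /s cos0 sin0; ring.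
have -> : Ex P (F' 0) = Ex P (fun w => 2 * a * q w ^+ 2 * dphi (s0 w) - r w * phi (s0 w)).
  by congr Ex; apply/funext => w; rewrite /F' cos0 sin0 s00; ring.
rewrite ExB; first by move/eqP; rewrite subr_eq0 => /eqP.
- apply: bddmM; last exact: bddm_nice ndphi bs0 (fun w => nsq_ge0 _).
  by apply: bddmZ; exact: bddmX.
- by apply: bddmM => //; exact: bddm_nice nphi bs0 (fun w => nsq_ge0 _).
Qed.

End stein.

(** * Spherical means and the Laplacian *)

Section nonneg_derivative.
Context {R : realType}.

(** The sign is asked for [x > 0] only: the derivatives met below, such as [x ^+ d.-1] times a
    nonnegative mean, may be negative for [x < 0]. *)
Lemma nondecreasing_of_derive (f f' : R -> R) :
  (forall x : R, is_derive x 1 f (f' x)) -> (forall x, 0 < x -> 0 <= f' x) ->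
  forall x y, 0 <= x -> x <= y -> f x <= f y.
Proof.
move=> df f'0 x y x0; rewrite le_eqVlt => /orP[/eqP -> //|xy].
have cf : {within `[x, y], continuous f}.
  by apply: derivable_within_continuous => z _; have [] := df z.
have [z zxy yx] := MVT xy (fun z _ => df z) cf.
rewrite -subr_ge0 yx mulr_ge0 ?subr_ge0 ?(ltW xy)// f'0//.
by move: zxy; rewrite in_itv/= => /andP[xz _]; exact: le_lt_trans xz.
Qed.
End nonneg_derivative.

Section radial.
Context {R : realType} {d : nat} {dO : measure_display} {Omega : measurableType dO}.
Variable P : probability Omega R.
Variables W X : Omega -> 'rV[R]_d.
Hypothesis hd : (1 < d)%N.
Hypotheses (bW : bddv W) (bX : bddv X) (X1 : forall w, nsq (X w) = 1).
Hypothesis rotX : rotinv P W X.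

Let T w := dotv (W w) (X w).
Let s (x : R) w := nsq (W w + x *: X w).

Let bT : bddm T. Proof. exact: bddm_dotv. Qed.
Let bs x : bddm (s x).
Proof. by apply: bddm_nsq; apply: bddvD => //; exact: bddvZ. Qed.
Let bNW : bddm (fun w => nsq (W w)). Proof. exact: bddm_nsq. Qed.
Let sE x w : s x w = nsq (W w) + x ^+ 2 + 2 * x * T w.
Proof. by rewrite /s nsqDZ X1 mulr1. Qed.
Let bphi phi x : nice phi -> bddm (fun w => phi (s x w)).
Proof. by move=> nphi; apply: bddm_nice => // w; exact: nsq_ge0. Qed.

(** Add the identities [stein_plane] over all ordered pairs of distinct coordinates. The terms [r]
    add up to [2 (d - 1) T], and the squares of the [q] to [2 (|W|^2 - T^2)] by Lagrange's identity
    and [|X| = 1]. *)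
Lemma stein (a : R) (phi dphi : R -> R) :
  nice phi -> nice dphi -> (forall s : R, 0 <= s -> is_derive s 1 phi (dphi s)) ->
  Ex P (fun w => (d%:R - 1) * T w * phi (s a w)) =
  Ex P (fun w => 2 * a * (nsq (W w) - T w ^+ 2) * dphi (s a w)).
Proof.
move=> nphi ndphi dE.
pose r i j w := W w ord0 i * X w ord0 i + W w ord0 j * X w ord0 j.
pose q i j w := W w ord0 j * X w ord0 i - W w ord0 i * X w ord0 j.
have br i j : bddm (fun w => r i j w * phi (s a w)).
  by apply: bddmM; [apply: bddmD; apply: bddmM | exact: bphi].
have bq i j : bddm (fun w => 2 * a * q i j w ^+ 2 * dphi (s a w)).
  apply: bddmM; last exact: bphi.
  by apply: bddmZ; apply: bddmX; apply: bddmB; apply: bddmM.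
have sumr w : \sum_i \sum_(j | i != j) r i j w = 2 * (d%:R - 1) * T w.
  have E i : \sum_(j | i != j) r i j w = \sum_j r i j w - 2 * (W w ord0 i * X w ord0 i).
    rewrite [in RHS](bigD1 i)//= (eq_bigl (fun j => j != i)) /r; first by ring.
    by move=> j; rewrite eq_sym.
  rewrite (eq_bigr _ (fun i _ => E i)) sumrB -mulr_sumr -/(dotv _ _).
  have E2 i : \sum_j r i j w = d%:R * (W w ord0 i * X w ord0 i) + T w.
    rewrite big_split/=; congr (_ + _).
    by rewrite sumr_const card_ord mulr_natl.
  rewrite (eq_bigr _ (fun i _ => E2 i)) big_split/= -mulr_sumr sumr_const card_ord.
  by rewrite -/(dotv _ _) -/(T w) -mulr_natl; ring.
have sumq w : \sum_i \sum_(j | i != j) q i j w ^+ 2 = 2 * (nsq (W w) - T w ^+ 2).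
  have E i : \sum_(j | i != j) q i j w ^+ 2 = \sum_j q i j w ^+ 2.
    rewrite [RHS](bigD1 i)//= [X in _ = X + _](_ : _ = 0) ?add0r.
      by apply: eq_bigl => j; rewrite eq_sym.
    by rewrite /q subrr expr0n.
  rewrite (eq_bigr _ (fun i _ => E i)).
  have E2 i : \sum_j q i j w ^+ 2 = nsq (W w) * X w ord0 i ^+ 2 +
      nsq (X w) * W w ord0 i ^+ 2 - 2 * T w * (W w ord0 i * X w ord0 i).
    rewrite /nsq /T /dotv mulr_sumr !mulr_suml -big_split -sumrB/=.
    by apply: eq_bigr => j _; rewrite /q; ring.
  rewrite (eq_bigr _ (fun i _ => E2 i)) sumrB big_split/= -!mulr_sumr.
  by rewrite -!/(nsq _) -/(dotv (W w) (X w)) -/(T w) X1; ring.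
have H : \sum_i \sum_(j | i != j) Ex P (fun w => r i j w * phi (s a w)) =
    \sum_i \sum_(j | i != j) Ex P (fun w => 2 * a * q i j w ^+ 2 * dphi (s a w)).
  by apply: eq_bigr => i _; apply: eq_bigr => j ij; exact: stein_plane.
have E1 : \sum_i \sum_(j | i != j) Ex P (fun w => r i j w * phi (s a w)) =
    2 * Ex P (fun w => (d%:R - 1) * T w * phi (s a w)).
  under eq_bigr do rewrite -Ex_sum//.
  rewrite -Ex_sum; last by move=> i; exact: bddm_sum.
  rewrite -ExZ; last by apply: bddmM; [exact: bddmZ | exact: bphi].
  congr Ex; apply/funext => w; under eq_bigr do rewrite -mulr_suml.
  by rewrite -mulr_suml sumr; ring.
have E2 : \sum_i \sum_(j | i != j) Ex P (fun w => 2 * a * q i j w ^+ 2 * dphi (s a w)) =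
    2 * Ex P (fun w => 2 * a * (nsq (W w) - T w ^+ 2) * dphi (s a w)).
  under eq_bigr do rewrite -Ex_sum//.
  rewrite -Ex_sum; last by move=> i; exact: bddm_sum.
  rewrite -ExZ; last first.
    apply: bddmM; last exact: bphi.
    by apply: bddmZ; apply: bddmB => //; exact: bddmX.
  congr Ex; apply/funext => w.
  under eq_bigr do rewrite -mulr_suml -mulr_sumr.
  by rewrite -mulr_suml -mulr_sumr sumq; ring.
by move: H; rewrite E1 E2 => /(mulfI _); apply; rewrite pnatr_eq0.
Qed.

Lemma radial_derive (phi dphi : R -> R) (c : R) (k : Omega -> R) (a : R) :
  nice phi -> nice dphi -> (forall s : R, 0 <= s -> is_derive s 1 phi (dphi s)) ->
  bddm k ->
  is_derive a 1 (fun x => Ex P (fun w => phi (s x w) * (c * x + k w)))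
    (Ex P (fun w => phi (s a w) * c +
                    (c * a + k w) * (dphi (s a w) * (2 * a + 2 * T w)))).
Proof.
move=> nphi ndphi dE bk.
have [_ [K hK]] := bk; have [_ [Q hQ]] := bT; have [_ [N hN]] := bNW.
pose A := `|a| + 1.
have xA x : `|x - a| < 1 -> `|x| <= A.
  by move=> xa; rewrite -[x](subrK a) addrC (le_trans (ler_normD _ _))// lerD2l ltW.
pose M := N + A ^+ 2 + 2 * A * Q.
have sM x w : `|x - a| < 1 -> 0 <= s x w <= M.
  move=> /xA xa; rewrite nsq_ge0/= sE /M; apply: lerD; last first.
    apply: (le_trans (ler_norm _)); rewrite !normrM ger0_norm//.
    by apply: ler_pM => //; rewrite ler_pM2l.
  apply: lerD; first exact: le_trans (ler_norm _) (hN w).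
  by rewrite -real_normK ?num_real// lerXn2r// nnegrE//; exact: le_trans xa.
have [C1 hC1] := nphi.2 M; have [C2 hC2] := ndphi.2 M.
pose F x w := phi (s x w) * (c * x + k w).
pose F' x w := phi (s x w) * c + (c * x + k w) * (dphi (s x w) * (2 * x + 2 * T w)).
apply: (@Ex_derive _ _ _ P F F' (C1 * `|c| + (`|c| * A + K) * (C2 * (2 * A + 2 * Q)))).
- move=> x w _.
  have ds : is_derive x 1 (s^~ w) (2 * x + 2 * T w).
    have -> : s^~ w = (fun x => nsq (W w) + x ^+ 2 + 2 * x * T w).
      by apply/funext => y; rewrite sE.
    apply: (der1_eq (der1_add (der1_add (der1_cst (nsq (W w)) x) (der1_exp 2 (der1_id x)))
      (der1_mul (der1_mul (der1_cst 2 x) (der1_id x)) (der1_cst (T w) x)))).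
    by rewrite /= expr1; ring.
  apply: (der1_eq (der1_mul
    (@der1_comp _ phi (s^~ w) _ _ _ (dE _ (nsq_ge0 _)) ds)
    (der1_add (der1_mul (der1_cst c x) (der1_id x)) (der1_cst (k w) x)))).
  by rewrite /F' /s; ring.
- move=> x; apply: bddmM; first exact: bphi.
  by apply: bddmD => //; exact: bddm_cst.
- move=> x w xa; have x1 := xA _ xa; have s1 := sM _ w xa.
  apply: (le_trans (ler_normD _ _)); rewrite !normrM; apply: lerD.
    by apply: ler_pM => //; exact: hC1.
  apply: ler_pM; rewrite ?mulr_ge0//.
    apply: (le_trans (ler_normD _ _)); rewrite normrM; apply: lerD => //.
    by rewrite ler_wpM2l.
  apply: ler_pM => //; first exact: hC2.
  apply: (le_trans (ler_normD _ _)); rewrite !normrM (@ger0_norm _ 2)//.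
  by apply: lerD; rewrite ler_pM2l.
Qed.

(* Half of [(a^(d-1) M'(a))' = a^(d-1) E ((Delta h) (W + a X))], for the spherical
   mean [M a = E (h (W + a X))] of [h z = g (|z|^2)] with [g' = g1] and [g'' = g2]. *)
Lemma radial_laplacian (g1 g2 : R -> R) (a : R) :
  nice g1 -> nice g2 -> (forall s : R, 0 <= s -> is_derive s 1 g1 (g2 s)) ->
  is_derive a 1 (fun x => x ^+ d.-1 * Ex P (fun w => g1 (s x w) * (x + T w)))
    (a ^+ d.-1 * Ex P (fun w => 2 * s a w * g2 (s a w) + d%:R * g1 (s a w))).
Proof.
move=> n1 n2 dg.
have D : is_derive a 1 (fun x => Ex P (fun w => g1 (s x w) * (x + T w)))
    (Ex P (fun w => g1 (s a w) * 1 +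
                    (1 * a + T w) * (g2 (s a w) * (2 * a + 2 * T w)))).
  have := radial_derive 1 a n1 n2 dg bT.
  by under eq_fun do under eq_fun do rewrite mul1r.
apply: (der1_eq (der1_mul (der1_exp d.-1 (der1_id a)) D)); rewrite mulr1.
have ad : a ^+ d.-1 = a * a ^+ d.-2 by rewrite -exprS; case: d hd => [|[]].
have dd : (d.-1)%:R = d%:R - 1 :> R by rewrite -subn1 natrB// ltnW.
have b1 := bphi a n1; have b2 := bphi a n2.
have bN2 : bddm (fun w => nsq (W w) - T w ^+ 2) by apply: bddmB => //; exact: bddmX.
(* The factor [x ^+ d.-1] contributes [d - 1] times the mean of [g1 * (a + T)]. By [stein] its part
   in [T] becomes a multiple of [|W|^2 - T^2], which together with the [(a + T)^2] from the chain
   rule gives exactly [|W + a X|^2]. *)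
have st : d.-1%:R * Ex P (fun w => g1 (s a w) * (a + T w)) =
    a * Ex P (fun w => (d%:R - 1) * g1 (s a w) +
                       2 * (nsq (W w) - T w ^+ 2) * g2 (s a w)).
  have bt : bddm (fun w => g1 (s a w) * (a + T w)).
    by apply: bddmM => //; apply: bddmD => //; exact: bddm_cst.
  rewrite dd -[LHS]ExZ//.
  transitivity (Ex P (fun w => (d%:R - 1) * a * g1 (s a w) +
                               (d%:R - 1) * T w * g1 (s a w))).
    by congr Ex; apply/funext => w; ring.
  rewrite ExD; [|exact: bddmZ|by apply: bddmM => //; exact: bddmZ].
  rewrite (stein a n1 n2 dg) -ExD; [|exact: bddmZ|]; last first.
    by apply: bddmM => //; exact: bddmZ.
  rewrite -ExZ; last first.
    by apply: bddmD; [exact: bddmZ | apply: bddmM => //; exact: bddmZ].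
  by congr Ex; apply/funext => w; ring.
rewrite mulrA (mulrC _ d.-1%:R) st mulrAC -ad -mulrDr -ExD; last 2 first.
- apply: bddmD; first by apply: bddmM => //; exact: bddm_cst.
  apply: bddmM; first by apply: bddmD => //; exact: bddm_cst.
  by apply: bddmM => //; apply: bddmD; [exact: bddm_cst | exact: bddmZ].
- by apply: bddmD; [exact: bddmZ | apply: bddmM => //; exact: bddmZ].
by congr (_ * Ex _ _); apply/funext => w; rewrite sE; ring.
Qed.

(** Multiplied by [a ^+ d.-1], the mean vanishes at [a = 0] because [d >= 2], and it is
    nondecreasing by [radial_laplacian]. *)
Lemma subharmonic_mean_derive_ge0 (g1 g2 : R -> R) (a : R) :
  nice g1 -> nice g2 -> (forall s : R, 0 <= s -> is_derive s 1 g1 (g2 s)) ->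
  (forall s : R, 0 <= s -> 0 <= 2 * s * g2 s + d%:R * g1 s) ->
  0 < a -> 0 <= Ex P (fun w => g1 (s a w) * (a + T w)).
Proof.
move=> n1 n2 dg pos a0.
have := nondecreasing_of_derive (fun x => radial_laplacian x n1 n2 dg) _ (lexx 0) (ltW a0).
have -> : 0 ^+ d.-1 = 0 :> R by rewrite expr0n; case: d hd => [|[]].
rewrite mul0r pmulr_rge0 ?exprn_gt0//.
apply=> x x0; apply: mulr_ge0; first by rewrite exprn_ge0// ltW.
by apply: Ex_ge0 => w; exact/pos/nsq_ge0.
Qed.

(** The derivative of the mean is twice the quantity of [subharmonic_mean_derive_ge0]; this is the
    classical growth of spherical means of a subharmonic function, here with a random centre [W]. *)
Lemma subharmonic_mean_nondecreasing (g g1 g2 : R -> R) (a b : R) :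
  nice g -> nice g1 -> nice g2 ->
  (forall s : R, 0 <= s -> is_derive s 1 g (g1 s)) ->
  (forall s : R, 0 <= s -> is_derive s 1 g1 (g2 s)) ->
  (forall s : R, 0 <= s -> 0 <= 2 * s * g2 s + d%:R * g1 s) ->
  0 <= a -> a <= b -> Ex P (fun w => g (s a w)) <= Ex P (fun w => g (s b w)).
Proof.
move=> n0 n1 n2 dg dg1 pos a0 ab.
have D (x : R) : is_derive x 1 (fun x => Ex P (fun w => g (s x w)))
    (2 * Ex P (fun w => g1 (s x w) * (x + T w))).
  have := radial_derive 0 x n0 n1 dg (bddm_cst 1).
  under eq_fun do under eq_fun do rewrite mul0r add0r mulr1.
  move=> /der1_eq; apply; rewrite -ExZ; last first.
    by apply: bddmM; [exact: bphi | apply: bddmD => //; exact: bddm_cst].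
  by congr Ex; apply/funext => w; ring.
apply: (nondecreasing_of_derive D _ a0 ab) => x x0.
by rewrite mulr_ge0//; exact: (subharmonic_mean_derive_ge0 n1 n2 dg1 pos).
Qed.

End radial.

(** * Mixed monotonicity for two spherical vectors *)

Section mixed.
Context {R : realType} {d : nat} {dO : measure_display} {Omega : measurableType dO}.
Variable P : probability Omega R.
Variables W X Y : Omega -> 'rV[R]_d.
Hypothesis hd : (1 < d)%N.
Hypotheses (bW : bddv W) (bX : bddv X) (bY : bddv Y).
Hypotheses (X1 : forall w, nsq (X w) = 1) (Y1 : forall w, nsq (Y w) = 1).
Hypothesis rotX : forall b, rotinv P (fun w => W w + b *: Y w) X.
Hypothesis rotY : forall a, rotinv P (fun w => W w + a *: X w) Y.

Let S a b w := W w + a *: X w + b *: Y w.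

(** Keep the radii [b <= c] of [Y] and let the radius [x] of [X] grow from 0. The difference of the
    two sides, times [x ^+ d.-1], starts at 0, and its derivative is [x ^+ d.-1] times the
    difference of the means of [h], half the Laplacian of the profile. As [h] is subharmonic, its
    mean grows with the radius of [Y], so this derivative is nonnegative. Dividing by [a ^+ d.-1]
    uses [0 < a]. *)
Lemma bisubharmonic_mean_derive_nondecreasing (g1 g2 h h1 h2 : R -> R) (a b c : R) :
  nice g1 -> nice g2 -> nice h -> nice h1 -> nice h2 ->
  (forall s : R, 0 <= s -> is_derive s 1 g1 (g2 s)) ->
  (forall s : R, h s = 2 * s * g2 s + d%:R * g1 s) ->
  (forall s : R, 0 <= s -> is_derive s 1 h (h1 s)) ->
  (forall s : R, 0 <= s -> is_derive s 1 h1 (h2 s)) ->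
  (forall s : R, 0 <= s -> 0 <= 2 * s * h2 s + d%:R * h1 s) ->
  0 < a -> 0 <= b -> b <= c ->
  Ex P (fun w => g1 (nsq (S a b w)) * dotv (S a b w) (X w)) <=
  Ex P (fun w => g1 (nsq (S a c w)) * dotv (S a c w) (X w)).
Proof.
move=> n1 n2 nh nh1 nh2 dg hE dh dh1 pos a0 b0 bc.
pose V b w := W w + b *: Y w.
have bV e : bddv (V e) by apply: bddvD => //; exact: bddvZ.
have SE x e w : S x e w = V e w + x *: X w by rewrite /S /V addrAC.
pose N x e := Ex P (fun w => h (nsq (S x e w))).
pose D x e := x ^+ d.-1 * Ex P (fun w => g1 (nsq (S x e w)) * dotv (S x e w) (X w)).
have dD (x : R) e : is_derive x 1 (D^~ e) (x ^+ d.-1 * N x e).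
  have := radial_laplacian hd (bV e) bX X1 (@rotX e) x n1 n2 dg.
  have -> : (fun x => x ^+ d.-1 * Ex P (fun w => g1 (nsq (V e w + x *: X w)) *
      (x + dotv (V e w) (X w)))) = D^~ e.
    apply/funext => y; congr (_ * Ex _ _); apply/funext => w.
    by rewrite SE dotvDl dotvZl -nsq_dot X1 mulr1 (addrC y).
  move=> /der1_eq; apply; congr (_ * Ex _ _); apply/funext => w.
  by rewrite SE hE.
have NE x : N x b <= N x c.
  apply: (subharmonic_mean_nondecreasing hd _ bY Y1 (@rotY x) nh nh1 nh2 dh dh1 pos b0 bc).
  by apply: bddvD => //; exact: bddvZ.
have := nondecreasing_of_derive (fun x => der1_sub (dD x c) (dD x b)) _ (lexx 0) (ltW a0).
have d0 : 0 ^+ d.-1 = 0 :> R by rewrite expr0n; case: d hd => [|[]].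
rewrite /D d0.
rewrite !mul0r subrr -mulrBr pmulr_rge0 ?exprn_gt0// subr_ge0; apply.
by move=> x x0; rewrite -mulrBr mulr_ge0 ?subr_ge0// exprn_ge0// ltW.
Qed.

End mixed.

(** * Regularized powers and the limit at the singularity *)

Section regularized_powers.
Context {R : realType}.
Implicit Types e q M s : R.

Lemma nice_powR e q : 0 < e -> nice (fun s => (e + s) `^ q).
Proof.
move=> e0; split.
  apply: (measurableT_comp (measurable_powR q)).
  by apply: measurable_funD => //; exact: measurable_cst.
move=> M; exists (e `^ q + (e + M) `^ q) => s /andP[s0 sM].
rewrite ger0_norm ?powR_ge0//; have [q0|q0] := leP 0 q.
  rewrite ler_wpDl ?powR_ge0// ge0_ler_powR// ?nnegrE; lra.
rewrite ler_wpDr ?powR_ge0// -[q]opprK powRN [leRHS]powRN.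
rewrite lef_pV2 ?posrE ?powR_gt0//; last by lra.
by apply: ge0_ler_powR; rewrite ?nnegrE; lra.
Qed.

Lemma derive_powR e q s : 0 < e -> 0 <= s ->
  is_derive s 1 (fun s => (e + s) `^ q) (q * (e + s) `^ (q - 1)).
Proof.
move=> e0 s0; have es : 0 < e + s by lra.
apply: (der1_eq (@der1_comp _ (fun u => u `^ q) (fun s => e + s) s _ _
  (is_derive1_powR q es) (der1_add (der1_cst e s) (der1_id s)))).
by rewrite add0r mulr1.
Qed.

Lemma niceZ c (g : R -> R) : nice g -> nice (fun s => c * g s).
Proof.
move=> [mg hg]; split; first by apply: measurable_funM => //; exact: measurable_cst.
move=> M; have [C hC] := hg M; exists (`|c| * C) => s /hC sC.
by rewrite normrM ler_wpM2l.
Qed.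

Lemma niceD (g h : R -> R) : nice g -> nice h -> nice (fun s => g s + h s).
Proof.
move=> [mg hg] [mh hh]; split; first exact: measurable_funD.
move=> M; have [C hC] := hg M; have [D hD] := hh M; exists (C + D) => s sM.
by apply: (le_trans (ler_normD _ _)); rewrite lerD ?hC ?hD.
Qed.

Lemma niceMid (g : R -> R) : nice g -> nice (fun s => s * g s).
Proof.
move=> [mg hg]; split; first exact: measurable_funM.
move=> M; have [C hC] := hg M; exists (M * C) => s sM.
by rewrite normrM ler_pM ?hC//; case/andP: sM => s0 sM; rewrite ger0_norm.
Qed.

(** Cauchy-Schwarz gains half a power. For [q = p / 2 - 1] the exponent on the right is
    [(p - 1) / 2], nonnegative when [1 <= p]: the gradient stays bounded near the origin, uniformly
    for [e] in a bounded range, although [q] may be negative. *)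
Lemma pow_grad_bound d e q (x y : 'rV[R]_d) : 0 <= e -> nsq y = 1 ->
  `|(e + nsq x) `^ q * dotv x y| <= (e + nsq x) `^ (q + 2^-1).
Proof.
move=> e0 y1; have x0 := nsq_ge0 x; have cs := cauchy_schwarz x y.
rewrite y1 mulr1 in cs.
have [u0|u0] := eqVneq (e + nsq x) 0.
  have -> : dotv x y = 0.
    by apply/eqP; rewrite -sqrf_eq0 eq_le sqr_ge0 andbT (le_trans cs)//; lra.
  by rewrite mulr0 normr0 powR_ge0.
have up : 0 <= e + nsq x by lra.
rewrite normrM ger0_norm ?powR_ge0// powRD ?u0 ?implybT//.
rewrite ler_wpM2l ?powR_ge0// powR12_sqrt// -sqrtr_sqr ler_wsqrtr//; lra.
Qed.

End regularized_powers.

Section expectation_limit.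
Context {R : realType} {dO : measure_display} {Omega : measurableType dO}.
Variable P : probability Omega R.

Lemma Ex_cvg (F : nat -> Omega -> R) (f : Omega -> R) (C : R) :
  (forall m, bddm (F m)) -> bddm f -> (forall m w, `|F m w| <= C) ->
  (forall w, F m w @[m --> \oo] --> f w) ->
  Ex P (F m) @[m --> \oo] --> Ex P f.
Proof.
move=> bF bf FC Ff.
have mF m : measurable_fun setT (EFin \o F m) by apply/measurable_EFinP; exact: (bF m).1.
have mf : measurable_fun setT (EFin \o f) by apply/measurable_EFinP; exact: bf.1.
have iC : P.-integrable setT (EFin \o (fun _ : Omega => C)).
  by apply: bddm_integrable; exact: bddm_cst.
have cv : {ae P, forall w, setT w -> (EFin \o F m) w @[m --> \oo] --> (EFin \o f) w}.
  by apply: aeW => w _; apply: cvg_EFin; [exact: nearW | exact: Ff].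
have ub : {ae P, forall w m, setT w ->
    (`|(EFin \o F m) w| <= (EFin \o (fun _ : Omega => C)) w)%E}.
  by apply: aeW => w m _; rewrite lee_fin.
have [_ _] := dominated_convergence measurableT mF mf cv iC ub.
move=> cvI; apply: fine_cvg.
rewrite fineK//; exact: (integrable_fin_num measurableT (bddm_integrable P bf)).
Qed.

End expectation_limit.

Section power_gradient.
Context {R : realType} {d : nat} {dO : measure_display} {Omega : measurableType dO}.
Variable P : probability Omega R.
Implicit Types (W X Y : Omega -> 'rV[R]_d) (p : R).

(** [p * pgrad p x y] is the derivative of [|x|^p] in the direction [y]. At [x = 0] it is 0,
    whatever value the power takes there. *)
Definition pgrad p (x y : 'rV[R]_d) := nsq x `^ (p / 2 - 1) * dotv x y.

Lemma bddm_pow_grad e q W X : 0 <= e -> - 2^-1 <= q ->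
  bddv W -> bddv X -> (forall w, nsq (X w) = 1) ->
  bddm (fun w => (e + nsq (W w)) `^ q * dotv (W w) (X w)).
Proof.
move=> e0 q0 bW bX X1; split.
  apply: measurable_funM; last exact: (bddm_dotv bW bX).1.
  apply: (measurableT_comp (measurable_powR q)).
  by apply: measurable_funD; [exact: measurable_cst | exact: (bddm_nsq bW).1].
have [_ [M hM]] := bddm_nsq bW; exists ((e + M) `^ (q + 2^-1)) => w.
apply: (le_trans (pow_grad_bound _ _ e0 (X1 w))).
have W0 := nsq_ge0 (W w); have WM := le_trans (ler_norm _) (hM w).
by apply: ge0_ler_powR; rewrite ?nnegrE; lra.
Qed.

Lemma bddm_pgrad p W X : 1 <= p -> bddv W -> bddv X -> (forall w, nsq (X w) = 1) ->
  bddm (fun w => pgrad p (W w) (X w)).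
Proof.
move=> p1 bW bX X1; under eq_fun do rewrite /pgrad -[nsq _]add0r.
by apply: bddm_pow_grad => //; lra.
Qed.

Lemma Ex_pgrad_cvg p W X : 1 <= p -> bddv W -> bddv X -> (forall w, nsq (X w) = 1) ->
  Ex P (fun w => (m.+1%:R^-1 + nsq (W w)) `^ (p / 2 - 1) * dotv (W w) (X w))
    @[m --> \oo] --> Ex P (fun w => pgrad p (W w) (X w)).
Proof.
move=> p1 bW bX X1; have [_ [M hM]] := bddm_nsq bW.
have v0 m : 0 <= m.+1%:R^-1 :> R by [].
have v1 m : m.+1%:R^-1 <= 1 :> R by rewrite invf_le1// ler1n.
apply: (Ex_cvg (C := (1 + M) `^ (p / 2 - 1 + 2^-1))).
- by move=> m; apply: bddm_pow_grad => //; lra.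
- exact: bddm_pgrad.
- move=> m w; apply: (le_trans (pow_grad_bound _ _ (v0 m) (X1 w))).
  have W0 := nsq_ge0 (W w); have WM := le_trans (ler_norm _) (hM w).
  move: (v0 m) (v1 m); set v := _^-1; clearbody v => v0m v1m.
  by apply: ge0_ler_powR; rewrite ?nnegrE; lra.
(* Where [W w = 0] the regularized power may blow up, but it is multiplied by an inner product equal
   to 0. *)
- move=> w; rewrite /pgrad; have [s0|s0] := eqVneq (nsq (W w)) 0.
    have -> : dotv (W w) (X w) = 0.
      apply/eqP; rewrite -sqrf_eq0 eq_le sqr_ge0 andbT.
      by rewrite (le_trans (cauchy_schwarz _ _))// s0 mul0r.
    by under eq_fun do rewrite mulr0; rewrite mulr0; exact: cvg_cst.
  apply: cvgM; last exact: cvg_cst.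
  have sp : 0 < nsq (W w) by rewrite lt_neqAle eq_sym s0 nsq_ge0.
  apply: (@continuous_cvg _ _ _ _ _ _ (fun u => u `^ (p / 2 - 1))).
    apply: differentiable_continuous; apply/derivable1_diffP.
    by apply: derivable_powR; rewrite in_itv/= andbT.
  rewrite -[X in _ --> X]add0r; apply: cvgD; last exact: cvg_cst.
  exact: cvg_harmonic.
Qed.

Variables W X Y : Omega -> 'rV[R]_d.
Hypothesis hd : (1 < d)%N.
Hypotheses (bW : bddv W) (bX : bddv X) (bY : bddv Y).
Hypotheses (X1 : forall w, nsq (X w) = 1) (Y1 : forall w, nsq (Y w) = 1).
Hypothesis rotX : forall b, rotinv P (fun w => W w + b *: Y w) X.
Hypothesis rotY : forall a, rotinv P (fun w => W w + a *: X w) Y.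

Let S a b w := W w + a *: X w + b *: Y w.
Let bS a b : bddv (S a b).
Proof. by apply: bddvD; [apply: bddvD => //|]; exact: bddvZ. Qed.

(** The sign [sg] lets one computation serve both ranges of [p]. For [q = p / 2 - 1] the quantity
    [2 * q + d - 2] is [p + d - 4]. *)
Lemma regularized_mixed_mono (sg q e a b c : R) : 0 < e ->
  0 <= sg * q -> 0 <= 2 * q + d%:R - 2 -> 0 < a -> 0 <= b -> b <= c ->
  sg * Ex P (fun w => (e + nsq (S a b w)) `^ q * dotv (S a b w) (X w)) <=
  sg * Ex P (fun w => (e + nsq (S a c w)) `^ q * dotv (S a c w) (X w)).
Proof.
move=> e0 sq qd a0 b0 bc.
pose g1 s := sg * (e + s) `^ q.
pose g2 s := sg * (q * (e + s) `^ (q - 1)).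
pose h s := 2 * (s * g2 s) + d%:R * g1 s.
pose g3 s := sg * (q * ((q - 1) * (e + s) `^ (q - 2))).
pose h1 s := 2 * (s * g3 s) + (2 + d%:R) * g2 s.
pose g4 s := sg * (q * ((q - 1) * ((q - 2) * (e + s) `^ (q - 3)))).
pose h2 s := 2 * (s * g4 s) + (4 + d%:R) * g3 s.
have n1 : nice g1 by apply: niceZ; exact: nice_powR.
have n2 : nice g2 by do 2! apply: niceZ; exact: nice_powR.
have n3 : nice g3 by do 3! apply: niceZ; exact: nice_powR.
have n4 : nice g4 by do 4! apply: niceZ; exact: nice_powR.
have nh : nice h by apply: niceD; apply: niceZ => //; exact: niceMid.
have nh1 : nice h1 by apply: niceD; apply: niceZ => //; exact: niceMid.
have nh2 : nice h2 by apply: niceD; apply: niceZ => //; exact: niceMid.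
have dZ (k x df : R) (f : R -> R) : is_derive x 1 f df ->
    is_derive x 1 (fun t => k * f t) (k * df).
  move=> df0; apply: (der1_eq (der1_mul (der1_cst k x) df0)).
  by rewrite mulr0 addr0.
have dg1 (s : R) : 0 <= s -> is_derive s 1 g1 (g2 s).
  by move=> s0; apply: (dZ); exact: derive_powR.
have dg2 (s : R) : 0 <= s -> is_derive s 1 g2 (g3 s).
  move=> s0; do 2! apply: (dZ); apply: (der1_eq (derive_powR (q - 1) e0 s0)).
  by congr (_ * _ `^ _); ring.
have dg3 (s : R) : 0 <= s -> is_derive s 1 g3 (g4 s).
  move=> s0; do 3! apply: (dZ); apply: (der1_eq (derive_powR (q - 2) e0 s0)).
  by congr (_ * _ `^ _); ring.
have dh (s : R) : 0 <= s -> is_derive s 1 h (h1 s).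
  move=> s0; apply: (der1_eq (der1_add
    (dZ 2 _ _ _ (der1_mul (der1_id s) (dg2 s s0))) (dZ d%:R _ _ _ (dg1 s s0)))).
  by rewrite /h1; ring.
have dh1 (s : R) : 0 <= s -> is_derive s 1 h1 (h2 s).
  move=> s0; apply: (der1_eq (der1_add
    (dZ 2 _ _ _ (der1_mul (der1_id s) (dg3 s s0))) (dZ (2 + d%:R) _ _ _ (dg2 s s0)))).
  by rewrite /h2; ring.
have pos (s : R) : 0 <= s -> 0 <= 2 * s * h2 s + d%:R * h1 s.
  move=> s0; have u0 : 0 < e + s by lra.
  have uS (k : R) : (e + s) `^ (k + 1) = (e + s) `^ k * (e + s).
    by rewrite powRD ?powRr1 ?ltW// (gt_eqF u0) implybT.
  have u2 : (e + s) `^ (q - 2) = (e + s) `^ (q - 3) * (e + s).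
    by rewrite -uS; congr (_ `^ _); ring.
  have u1 : (e + s) `^ (q - 1) = (e + s) `^ (q - 3) * (e + s) ^+ 2.
    by rewrite expr2 mulrA -u2 -uS; congr (_ `^ _); ring.
  rewrite /h2 /h1 /g4 /g3 /g2 u1 u2.
  (* What is left after factoring is a quadratic form in [s] and [e] with nonnegative coefficients.
     For [q = p / 2 - 1] its [s ^+ 2] coefficient is [(p + d - 2) (p + d - 4)], the factor seen
     without regularization. *)
  have -> : forall z, 2 * s * (2 * (s * (sg * (q * ((q - 1) * ((q - 2) * z))))) +
      (4 + d%:R) * (sg * (q * ((q - 1) * (z * (e + s)))))) +
      d%:R * (2 * (s * (sg * (q * ((q - 1) * (z * (e + s)))))) +
      (2 + d%:R) * (sg * (q * (z * (e + s) ^+ 2)))) =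
    sg * q * z * ((2 * q + d%:R) * (2 * q + d%:R - 2) * s ^+ 2 +
      2 * (d%:R + 2) * (2 * q + d%:R - 2) * (s * e) + d%:R * (d%:R + 2) * e ^+ 2).
    by move=> z; ring.
  apply: mulr_ge0; first by rewrite mulr_ge0 ?powR_ge0.
  have dp : 0 <= d%:R :> R by [].
  apply: addr_ge0; last by rewrite mulr_ge0 ?sqr_ge0 ?mulr_ge0//; lra.
  apply: addr_ge0; apply: mulr_ge0; rewrite ?sqr_ge0 ?(mulr_ge0 s0 (ltW e0))//.
    by apply: mulr_ge0; lra.
  by apply: mulr_ge0; lra.
have hE s : h s = 2 * s * g2 s + d%:R * g1 s by rewrite /h mulrA.
have := bisubharmonic_mean_derive_nondecreasing hd bW bX bY X1 Y1 rotX rotY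
  n1 n2 nh nh1 nh2 dg1 hE dh dh1 pos a0 b0 bc.
have E k : Ex P (fun w => g1 (nsq (S a k w)) * dotv (S a k w) (X w)) =
    sg * Ex P (fun w => (e + nsq (S a k w)) `^ q * dotv (S a k w) (X w)).
  rewrite -ExZ; first by congr Ex; apply/funext => w; rewrite /g1 mulrA.
  apply: bddmM; last exact: bddm_dotv.
  by apply: (bddm_nice (nice_powR q e0) (bddm_nsq (bS a k))) => w; exact: nsq_ge0.
by rewrite -!E.
Qed.

Lemma pgrad_mixed_mono (sg p a b c : R) : 1 <= p ->
  0 <= sg * (p - 2) -> 0 <= p + d%:R - 4 -> 0 < a -> 0 <= b -> b <= c ->
  sg * Ex P (fun w => pgrad p (S a b w) (X w)) <=
  sg * Ex P (fun w => pgrad p (S a c w) (X w)).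
Proof.
move=> p1 sp pd a0 b0 bc.
have cv k : sg * Ex P (fun w => (m.+1%:R^-1 + nsq (S a k w)) `^ (p / 2 - 1) *
    dotv (S a k w) (X w)) @[m --> \oo] --> sg * Ex P (fun w => pgrad p (S a k w) (X w)).
  by apply: cvgM; [exact: cvg_cst | exact: Ex_pgrad_cvg].
apply: (ler_cvg_to (cv b) (cv c)); apply: nearW => m.
apply: regularized_mixed_mono => //; last by lra.
have -> : sg * (p / 2 - 1) = sg * (p - 2) / 2 by field.
by rewrite divr_ge0.
Qed.

End power_gradient.

(** * Convexity of powers *)

Section powers.
Context {R : realType}.
Implicit Types p x y : R.

Lemma powR_tangent p x y : 1 <= p -> 0 < x -> 0 <= y ->
  x `^ p + p * x `^ (p - 1) * (y - x) <= y `^ p.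
Proof.
move=> p1 x0 y0; have p0 : 0 < p by lra.
have df (z : R) : 0 < z -> is_derive z 1 (fun z => z `^ p - p * x `^ (p - 1) * z)
    (p * z `^ (p - 1) - p * x `^ (p - 1)).
  move=> z0; apply: (der1_eq (der1_sub (is_derive1_powR p z0)
    (der1_mul (der1_cst (p * x `^ (p - 1)) z) (der1_id z)))).
  by rewrite mulr1 mulr0 addr0.
have mono u v : 0 <= u -> u <= v -> u `^ (p - 1) <= v `^ (p - 1).
  by move=> u0 uv; apply: ge0_ler_powR; rewrite ?nnegrE; lra.
(* The derivative of the power is available at positive points only, so [y = 0] is checked by hand;
   there the left side is [(1 - p) x^p]. *)
have [y00|yp] := eqVneq y 0.
  rewrite y00 powR0 ?gt_eqF// sub0r mulrN -mulrA (mulrC _ x) mulr_powRB1 ?(ltW x0)//.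
  by have := powR_ge0 x p; nra.
have {y0 yp} y0 : 0 < y by rewrite lt_neqAle eq_sym yp.
have cf u v : 0 < u -> {within `[u, v], continuous (fun z => z `^ p - p * x `^ (p - 1) * z)}.
  move=> u0; apply: derivable_within_continuous => z.
  by rewrite in_itv/= => /andP[uz _]; have [] := df z (lt_le_trans u0 uz).
have [xy|yx|->] := ltgtP x y; last by rewrite subrr mulr0 addr0.
- have [z] := MVT xy (fun z zi => df z (lt_le_trans x0 (ltW (proj1 (andP zi))))) (cf _ _ x0).
  rewrite in_itv/= => /andP[xz zy] E.
  have : 0 <= (p * z `^ (p - 1) - p * x `^ (p - 1)) * (y - x).
    rewrite mulr_ge0 ?subr_ge0 ?(ltW xy)// ler_pM2l// mono// ltW//.
  by rewrite -E; lra.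
- have [z] := MVT yx (fun z zi => df z (lt_le_trans y0 (ltW (proj1 (andP zi))))) (cf _ _ y0).
  rewrite in_itv/= => /andP[yz zx] E.
  have : (p * z `^ (p - 1) - p * x `^ (p - 1)) * (x - y) <= 0.
    rewrite mulr_le0_ge0 ?subr_ge0 ?(ltW yx)// subr_le0 ler_pM2l// mono// ltW//.
    exact: lt_trans yz.
  by rewrite -E; lra.
Qed.

Lemma powR_cvg p (u : nat -> R) (l : R) : 1 <= p -> (forall n, 0 <= u n) ->
  u n @[n --> \oo] --> l -> u n `^ p @[n --> \oo] --> l `^ p.
Proof.
move=> p1 u0 ul.
have l0 : 0 <= l by apply: (cvgr_to_ge ul); apply: nearW => n.
have [l00|lp] := eqVneq l 0; last first.
  apply: (@continuous_cvg _ _ _ _ _ _ (fun u => u `^ p)) => //.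
  apply: differentiable_continuous; apply/derivable1_diffP.
  by apply: derivable_powR; rewrite in_itv/= andbT lt_neqAle eq_sym lp.
(* At the limit 0 continuity is replaced by the squeeze [0 <= u^p <= u], valid once [u < 1]. *)
rewrite l00 powR0 ?gt_eqF//; last by lra.
have ul0 : u n @[n --> \oo] --> 0 by rewrite -l00.
apply: (squeeze_cvgr _ (cvg_cst 0) ul0).
have u1 : \forall n \near \oo, u n < 1 by exact: cvgr_lt ul0 _ ltr01.
near=> n; rewrite powR_ge0/=.
have [->|un] := eqVneq (u n) 0; first by rewrite powR0// gt_eqF//; lra.
apply: ge1r_powR => //; rewrite lt_neqAle eq_sym un u0/=.
by apply: ltW; near: n.
Unshelve. all: end_near. Qed.

Context {d : nat}.
Implicit Types v w : 'rV[R]_d.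

(** The tangent of [r^p] at [r = |v|], followed by Cauchy-Schwarz, gives the supporting hyperplane
    of [|x|^p] at [v]. *)
Lemma nsq_pow_tangent p v w : 1 <= p ->
  nsq v `^ (p / 2) + p * (nsq v `^ (p / 2 - 1) * (dotv v w - nsq v)) <= nsq w `^ (p / 2).
Proof.
move=> p1; have [v0|v0] := eqVneq (nsq v) 0.
  rewrite v0 powR0; last by rewrite gt_eqF//; lra.
  have -> : dotv v w = 0.
    apply/eqP; rewrite -sqrf_eq0 eq_le sqr_ge0 andbT.
    by rewrite (le_trans (cauchy_schwarz _ _))// v0 mul0r.
  by rewrite subrr !mulr0 addr0 powR_ge0.
have vp : 0 < nsq v by rewrite lt_neqAle eq_sym v0 nsq_ge0.
have hpow u r : 0 <= u -> Num.sqrt u `^ r = u `^ (r / 2).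
  by move=> u0; rewrite -powR12_sqrt// -powRrM mulrC.
have sp : 0 < Num.sqrt (nsq v) by rewrite sqrtr_gt0.
have := powR_tangent p1 sp (sqrtr_ge0 (nsq w)).
rewrite !hpow ?nsq_ge0//; apply: le_trans; rewrite lerD2l -mulrA ler_wpM2l//; first by lra.
have -> : (p - 1) / 2 = (p / 2 - 1) + 2^-1 by field.
rewrite [_ `^ (_ + 2^-1)]powRD ?v0 ?implybT// powR12_sqrt ?nsq_ge0// -mulrA ler_wpM2l ?powR_ge0//.
rewrite mulrBr -expr2 sqr_sqrtr ?nsq_ge0// lerB//.
rewrite (le_trans (ler_norm _))// -sqrtr_sqr -sqrtrM ?nsq_ge0//.
by rewrite ler_wsqrtr// cauchy_schwarz.
Qed.

End powers.

(** * Moments of spherical sums and their subgradients *)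

Section spherical_sums.
Context {R : realType} {d n : nat} {dO : measure_display} {Omega : measurableType dO}.
Variable P : probability Omega R.
Variable X : 'I_n -> Omega -> 'rV[R]_d.
Hypothesis bX : forall k, bddv (X k).
Hypothesis X1 : forall k w, nsq (X k w) = 1.
Hypothesis rotX : forall k (b : 'I_n -> R),
  rotinv P (fun w => \sum_(i | i != k) b i *: X i w) (X k).
Implicit Types (a b c : 'I_n -> R) (p : R).

Definition vsum b w := \sum_k b k *: X k w.
Definition moment p b := Ex P (fun w => nsq (vsum b w) `^ (p / 2)).
(* [p * dmoment p k b] is the partial derivative of [moment p] in [b k]. *)
Definition dmoment p k b := Ex P (fun w => pgrad p (vsum b w) (X k w)).

Let bS b : bddv (vsum b).
Proof. by apply: bddv_sum => k; exact: bddvZ. Qed.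

Let bD p k b : 1 <= p -> bddm (fun w => pgrad p (vsum b w) (X k w)).
Proof. by move=> p1; exact: bddm_pgrad. Qed.

Let bM p W : 0 <= p -> bddv W -> bddm (fun w : Omega => nsq (W w : 'rV[R]_d) `^ (p / 2)).
Proof.
move=> p0 bW; split.
  exact: (measurableT_comp (measurable_powR _) (bddm_nsq bW).1).
have [_ [M hM]] := bddm_nsq bW; exists (M `^ (p / 2)) => w.
have W0 := nsq_ge0 (W w); have WM := le_trans (ler_norm _) (hM w).
rewrite ger0_norm ?powR_ge0//.
by apply: ge0_ler_powR; rewrite ?nnegrE; lra.
Qed.

Lemma vsum_split b k w : vsum b w = \sum_(i | i != k) b i *: X i w + b k *: X k w.
Proof. by rewrite /vsum (bigD1 k)//= addrC. Qed.

Lemma moment_tangent p b c : 1 <= p ->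
  moment p b + p * \sum_k (c k - b k) * dmoment p k b <= moment p c.
Proof.
move=> p1; have p0 : 0 <= p by lra.
have bsum : bddm (fun w => \sum_k (c k - b k) * pgrad p (vsum b w) (X k w)).
  by apply: bddm_sum => k; apply: bddmZ; exact: bD.
have -> : \sum_k (c k - b k) * dmoment p k b =
    Ex P (fun w => \sum_k (c k - b k) * pgrad p (vsum b w) (X k w)).
  rewrite Ex_sum; last by move=> k; apply: bddmZ; exact: bD.
  by apply: eq_bigr => k _; rewrite ExZ//; exact: bD.
rewrite -ExZ// -ExD; [|exact: bM|exact: bddmZ].
apply: le_Ex; [by apply: bddmD; [exact: bM|exact: bddmZ]|exact: bM|].
move=> w; apply: le_trans (nsq_pow_tangent (vsum b w) (vsum c w) p1).
rewrite lerD2l ler_wpM2l// /pgrad nsq_dot -!/(vsum _ _).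
have -> : \sum_k (c k - b k) * (nsq (vsum b w) `^ (p / 2 - 1) * dotv (vsum b w) (X k w)) =
  nsq (vsum b w) `^ (p / 2 - 1) * \sum_k (c k - b k) * dotv (vsum b w) (X k w).
  by rewrite mulr_sumr; apply: eq_bigr => k _; rewrite mulrCA.
rewrite -nsq_dot ler_wpM2l ?powR_ge0//.
have E e : dotv (vsum b w) (vsum e w) = \sum_k e k * dotv (vsum b w) (X k w).
  rewrite dotvC dotv_suml; apply: eq_bigr => k _.
  by rewrite dotvZl dotvC.
by rewrite nsq_dot !E -sumrB; under [leRHS]eq_bigr do rewrite -mulrBl.
Qed.

Lemma rotinv_opp k b (psi : 'rV[R]_d * 'rV[R]_d -> R) : measurable_fun setT psi ->
  let W w := \sum_(i | i != k) b i *: X i w in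
  bddm (fun w => psi (W w, X k w)) -> bddm (fun w => psi (W w, - X k w)) ->
  Ex P (fun w => psi (W w, X k w)) = Ex P (fun w => psi (W w, - X k w)).
Proof.
move=> mpsi W b1 b2.
have O1 : (- 1%:M) *m (- 1%:M)^T = 1%:M :> 'M[R]_d.
  by rewrite linearN/= trmx1 mulNmx mulmxN opprK mulmx1.
have E w : X k w *m (- 1%:M) = - X k w by rewrite mulmxN mulmx1.
have := rotX O1 mpsi b1; rewrite -/W.
have -> : (fun w => psi (W w, X k w *m - 1%:M)) = (fun w => psi (W w, - X k w)).
  by apply/funext => w; rewrite E.
by apply.
Qed.

Let m1 k : measurable_fun setT (fun z : 'rV[R]_d * 'rV[R]_d => z.1 ord0 k).
Proof. exact: (measurableT_comp (measurable_coord k) measurable_fst). Qed.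

Let m2 k : measurable_fun setT (fun z : 'rV[R]_d * 'rV[R]_d => z.2 ord0 k).
Proof. exact: (measurableT_comp (measurable_coord k) measurable_snd). Qed.

Let mlin (a : R) k : measurable_fun setT
  (fun z : 'rV[R]_d * 'rV[R]_d => (z.1 + a *: z.2) ord0 k).
Proof.
under eq_fun do rewrite !mxE.
by apply: measurable_funD => //; apply: measurable_funM.
Qed.

Definition flip k b := fun i => if i == k then - b i else b i.

Lemma vsum_flip k b w :
  vsum (flip k b) w = \sum_(i | i != k) b i *: X i w + b k *: - X k w.
Proof.
rewrite (vsum_split _ k) /flip eqxx scaleNr scalerN; congr (_ + _).
by apply: eq_bigr => i /negPf ->.
Qed.

Lemma moment_flip p k b : 0 <= p -> moment p (flip k b) = moment p b.
Proof.
move=> p0; pose psi (z : 'rV[R]_d * 'rV[R]_d) := nsq (z.1 + b k *: z.2) `^ (p / 2).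
have mpsi : measurable_fun setT psi.
  by apply: (measurableT_comp (measurable_powR _)); exact: measurable_nsq.
pose W w := \sum_(i | i != k) b i *: X i w.
have E1 : (fun w => psi (W w, X k w)) = (fun w => nsq (vsum b w) `^ (p / 2)).
  by apply/funext => w; rewrite /psi /= -vsum_split.
have E2 : (fun w => psi (W w, - X k w)) = (fun w => nsq (vsum (flip k b) w) `^ (p / 2)).
  by apply/funext => w; rewrite /psi /= -vsum_flip.
have h : bddm (fun w => psi (W w, X k w)) -> bddm (fun w => psi (W w, - X k w)) ->
    Ex P (fun w => psi (W w, X k w)) = Ex P (fun w => psi (W w, - X k w)).
  exact: (@rotinv_opp k b psi mpsi).
rewrite /moment -E1 -E2; apply/esym/h; [rewrite E1|rewrite E2]; exact: bM.
Qed.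

(** If [b k = 0] then [vsum b] does not involve [X k], so replacing [X k] by [- X k] keeps the law
    and reverses the sign of the integrand. *)
Lemma dmoment_eq0 p k b : 1 <= p -> b k = 0 -> dmoment p k b = 0.
Proof.
move=> p1 bk0; pose psi (z : 'rV[R]_d * 'rV[R]_d) := pgrad p z.1 z.2.
have mpsi : measurable_fun setT psi.
  apply: measurable_funM; last exact: measurable_dotv.
  by apply: (measurableT_comp (measurable_powR _)); exact: measurable_nsq.
pose W w := \sum_(i | i != k) b i *: X i w.
have E1 : (fun w => psi (W w, X k w)) = (fun w => pgrad p (vsum b w) (X k w)).
  by apply/funext => w; rewrite /psi /= (vsum_split b k) bk0 scale0r addr0.
have E2 : (fun w => psi (W w, - X k w)) = (fun w => - pgrad p (vsum b w) (X k w)).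
  apply/funext => w; rewrite /psi /= (vsum_split b k) bk0 scale0r addr0 /pgrad.
  by rewrite -[- X k w]scaleN1r dotvZr mulrCA mulN1r.
have h : bddm (fun w => psi (W w, X k w)) -> bddm (fun w => psi (W w, - X k w)) ->
    Ex P (fun w => psi (W w, X k w)) = Ex P (fun w => psi (W w, - X k w)).
  exact: (@rotinv_opp k b psi mpsi).
move: h; rewrite E1 E2 => /(_ (bD _ _ p1) (bddmN (bD _ _ p1))).
by rewrite ExN ?/dmoment; [lra | exact: bD].
Qed.

(** [moment] takes the same value at [b] and at the reflected point [flip k b]. The tangent at [b],
    read at that point, must not lie above this value, and it differs from it by
    [- 2 p * b k * dmoment p k b]. *)
Lemma dmoment_ge0 p k b : 1 <= p -> 0 <= b k -> 0 <= dmoment p k b.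
Proof.
move=> p1; rewrite le_eqVlt => /orP[/eqP/esym/(dmoment_eq0 p1) ->//|bk].
have := moment_tangent b (flip k b) p1.
rewrite moment_flip; last by lra.
rewrite (bigD1 k)//= big1 => [|i /negPf ik]; last by rewrite /flip ik subrr mul0r.
rewrite addr0 /flip eqxx gerDl -opprD mulNr mulrN oppr_le0.
by rewrite pmulr_rge0 ?pmulr_rge0 ?addr_gt0//; lra.
Qed.

Lemma moment_mono p b c : 1 <= p -> (forall k, 0 <= b k <= c k) ->
  moment p b <= moment p c.
Proof.
move=> p1 bc; apply: le_trans (moment_tangent b c p1).
rewrite lerDl mulr_ge0//; first by lra.
apply: sumr_ge0 => k _; case/andP: (bc k) => b0 bck.
by rewrite mulr_ge0 ?subr_ge0// dmoment_ge0.
Qed.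

(** The coordinates are made nonnegative one at a time, each by a [flip]. This reduces signed
    function values to the nonnegative coefficients used in the tangent inequality. *)
Lemma moment_abs p b : 0 <= p -> moment p (fun k => `|b k|) = moment p b.
Proof.
move=> p0.
pose c (m : nat) (k : 'I_n) := if (k < m)%N then `|b k| else b k.
have -> : (fun k => `|b k|) = c n by apply/funext => k; rewrite /c ltn_ord.
suff H m : (m <= n)%N -> moment p (c m) = moment p (c 0%N) by rewrite H.
elim: m => [//|m ih mn]; apply: (etrans _ (ih (ltnW mn))) => {ih}.
pose k := Ordinal mn.
have cE i : i != k -> c m.+1 i = c m i.
  move=> ik; rewrite /c ltnS leq_eqVlt; suff /negPf -> : nat_of_ord i != m by [].
  by apply: contraNneq ik => im; apply/eqP/val_inj.
have ck : c m.+1 k = `|b k| by rewrite /c /= ltnSn.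
have ck' : c m k = b k by rewrite /c /= ltnn.
have [b0|b0] := leP 0 (b k).
  congr moment; apply/funext => i; have [->|/cE//] := eqVneq i k.
  by rewrite ck ck' ger0_norm.
rewrite -(moment_flip k _ p0); congr moment; apply/funext => i; rewrite /flip.
have [->|/cE//] := eqVneq i k.
by rewrite ck ck' ltr0_norm// opprK.
Qed.

Lemma vsumZ (t : R) b w : vsum (fun k => t * b k) w = t *: vsum b w.
Proof. by rewrite scaler_sumr; apply: eq_bigr => k _; rewrite scalerA. Qed.

Lemma nsqZ_pow (t r : R) (v : 'rV[R]_d) : 0 <= t ->
  nsq (t *: v) `^ r = t `^ (2 * r) * nsq v `^ r.
Proof.
by move=> t0; rewrite nsqZ powRM ?sqr_ge0 ?nsq_ge0// -powR_mulrn// -powRrM.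
Qed.

Lemma momentZ p (t : R) b : 0 <= p -> 0 <= t ->
  moment p (fun k => t * b k) = t `^ p * moment p b.
Proof.
move=> p0 t0; rewrite /moment -ExZ; last exact: bM.
congr Ex; apply/funext => w; rewrite vsumZ nsqZ_pow//.
by congr (_ `^ _ * _); field.
Qed.

Lemma dmomentZ p k (t : R) b : 1 <= p -> 0 < t ->
  dmoment p k (fun k => t * b k) = t `^ (p - 1) * dmoment p k b.
Proof.
move=> p1 t0; rewrite /dmoment -ExZ; last exact: bD.
congr Ex; apply/funext => w; rewrite /pgrad vsumZ nsqZ_pow ?(ltW t0)// dotvZl.
have -> : 2 * (p / 2 - 1) = p - 1 - 1 by field.
have -> : t `^ (p - 1) = t * t `^ (p - 1 - 1).
  have -> : p - 1 = p - 1 - 1 + 1 by ring.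
  rewrite [in LHS]powRD ?(gt_eqF t0) ?implybT// powRr1 ?ltW// mulrC.
  by congr (_ * _ `^ _); ring.
ring.
Qed.

Hypothesis hd : (1 < d)%N.

(** Coordinates are raised from [b] to [c] one at a time. When the coordinate [j] moves, [X k] and
    [X j] are the two vectors of [pgrad_mixed_mono] and the remaining terms form its [W]. *)
Lemma dmoment_mono (sg : R) p k b c : 1 <= p -> 0 <= sg * (p - 2) ->
  0 <= p + d%:R - 4 -> (forall j, 0 <= b j <= c j) -> b k = c k -> 0 < b k ->
  sg * dmoment p k b <= sg * dmoment p k c.
Proof.
move=> p1 sp pd bc bck bk0.
pose e (m : nat) (j : 'I_n) := if (j < m)%N then c j else b j.
have -> : c = e n by apply/funext => j; rewrite /e ltn_ord.
suff H m : (m <= n)%N -> sg * dmoment p k (e 0%N) <= sg * dmoment p k (e m).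
  exact: H.
elim: m => [//|m ih mn]; apply: (le_trans (ih (ltnW mn))) => {ih}.
pose j := Ordinal mn.
have eE i : i != j -> e m.+1 i = e m i.
  move=> ij; rewrite /e ltnS leq_eqVlt; suff /negPf -> : nat_of_ord i != m by [].
  by apply: contraNneq ij => im; apply/eqP/val_inj.
have ej : e m.+1 j = c j by rewrite /e /= ltnSn.
have ej' : e m j = b j by rewrite /e /= ltnn.
have ek : e m k = b k by rewrite /e bck; case: ifP.
have [jk|jk] := eqVneq j k.
  suff -> : e m.+1 = e m by [].
  by apply/funext => i; have [->|/eE//] := eqVneq i j; rewrite ej ej' jk bck.
pose W w := \sum_(i | (i != k) && (i != j)) e m i *: X i w.
have rY (r : R) (l l' : 'I_n) : l' != l ->
    rotinv P (fun w => \sum_(i | (i != l) && (i != l')) e m i *: X i w + r *: X l' w) (X l).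
  move=> ll; pose f i := if i == l' then r else e m i.
  have -> : (fun w => \sum_(i | (i != l) && (i != l')) e m i *: X i w + r *: X l' w) =
      (fun w => \sum_(i | i != l) f i *: X i w).
    apply/funext => w; rewrite [RHS](bigD1 l')//= addrC /f eqxx; congr (_ + _).
    by apply: eq_bigr => i /andP[_ /negPf ->].
  exact: rotX.
have rX' r : rotinv P (fun w => W w + r *: X j w) (X k) by exact: rY.
have rY' r : rotinv P (fun w => W w + r *: X k w) (X j).
  have -> : W = (fun w => \sum_(i | (i != j) && (i != k)) e m i *: X i w).
    by apply/funext => w; apply: eq_bigl => i; rewrite andbC.
  by apply: rY; rewrite eq_sym.
have bW : bddv W by apply: bddv_sum => i; exact: bddvZ.
case/andP: (bc j) => bj0 bcj.
have := pgrad_mixed_mono hd bW (bX k) (bX j) (X1 k) (X1 j) rX' rY' p1 sp pd bk0 bj0 bcj.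
have SE f w : (forall i, i != j -> f i = e m i) ->
    vsum f w = W w + b k *: X k w + f j *: X j w.
  move=> fE; rewrite (vsum_split _ k) (bigD1 j)//= (fE k) 1?eq_sym// ek /W.
  rewrite -addrA addrC; congr (_ + _ + _).
  by apply: eq_bigr => i /andP[_ /fE ->].
have DE f : (forall i, i != j -> f i = e m i) -> dmoment p k f =
    Ex P (fun w => pgrad p (W w + b k *: X k w + f j *: X j w) (X k w)).
  by move=> fE; congr Ex; apply/funext => w; rewrite SE.
by rewrite (DE _ eE) (DE (e m) (fun i _ => erefl)) ej ej'.
Qed.

End spherical_sums.

(** * The supporting hyperplane in the variables [b k ^ p] *)

Section tangent.
Context {R : realType} {d n : nat} {dO : measure_display} {Omega : measurableType dO}.
Variable P : probability Omega R.
Variable X : 'I_n -> Omega -> 'rV[R]_d.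
Hypothesis bX : forall k, bddv (X k).
Hypothesis X1 : forall k w, nsq (X k w) = 1.
Hypothesis rotX : forall k (b : 'I_n -> R),
  rotinv P (fun w => \sum_(i | i != k) b i *: X i w) (X k).
Hypothesis hd : (1 < d)%N.
Variables (p : R) (a : 'I_n -> R).
Hypotheses (p1 : 1 <= p) (a0 : forall k, 0 <= a k).

Let p_gt0 : 0 < p. Proof. by apply: lt_le_trans p1. Qed.
Let p_ge0 : 0 <= p. Proof. exact: ltW. Qed.

Local Notation moment := (moment P X p).
Local Notation dmoment := (dmoment P X p).

(** In the variables [u k = b k ^ p], this is [u k] times the partial derivative of [moment] in
    [u k], at [b = a]: the slope of the tangent with respect to the ratio [l k ^ p]. *)
Definition weight k := a k * dmoment k a.

Lemma weight_ge0 k : 0 <= weight k.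
Proof. by rewrite /weight mulr_ge0// dmoment_ge0. Qed.

(** Euler's identity, which holds pointwise: the gradient of [|x|^p] at [x = vsum X a w] is paired
    with [x] itself. *)
Lemma sum_weight : \sum_k weight k = moment a.
Proof.
have bD k : bddm (fun w => pgrad p (vsum X a w) (X k w)).
  by apply: bddm_pgrad => //; apply: bddv_sum => i; exact: bddvZ.
have -> : \sum_k weight k = Ex P (fun w => \sum_k a k * pgrad p (vsum X a w) (X k w)).
  rewrite Ex_sum; last by move=> k; exact: bddmZ.
  by apply: eq_bigr => k _; rewrite ExZ.
congr Ex; apply/funext => w; rewrite /pgrad.
have -> : \sum_k a k * (nsq (vsum X a w) `^ (p / 2 - 1) * dotv (vsum X a w) (X k w)) =
    nsq (vsum X a w) `^ (p / 2 - 1) * nsq (vsum X a w).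
  rewrite [X in _ = _ * X]nsq_dot {4}/vsum dotvC dotv_suml mulr_sumr.
  by apply: eq_bigr => k _; rewrite dotvZl dotvC mulrCA.
by rewrite mulrC mulr_powRB1 ?nsq_ge0// divr_gt0// p_gt0.
Qed.

(** Position at time [i] on the path from 0 to the point [a k * m k]: each coordinate advances by
    [a k] per step and stops on reaching its goal. *)
Let amin (m : 'I_n -> nat) i k := a k * (minn (m k) i)%:R.

Let aminS m i k : amin m i.+1 k - amin m i k = if (i < m k)%N then a k else 0.
Proof.
rewrite /amin -mulrBr; case: ifPn => [im|]; last first.
  by rewrite -leqNgt => mi; rewrite !(minn_idPl _) ?subrr ?mulr0// ltnW.
by rewrite !(minn_idPr _) ?(ltnW im)// -natrB// subSnn mulr1.
Qed.

Let amin_ge0 m i k : 0 <= amin m i k.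
Proof. by rewrite mulr_ge0. Qed.

Let amin_max m : amin m (\max_k m k) = (fun k => a k * (m k)%:R).
Proof. by apply/funext => k; rewrite /amin (minn_idPl _)// leq_bigmax. Qed.

Let amin_le m i k : amin m i k <= i%:R * a k.
Proof. by rewrite /amin mulrC ler_wpM2r// ler_nat geq_minr. Qed.

Let moment0 m : moment (amin m 0) = 0.
Proof.
rewrite /moment (_ : (fun _ => _) = fun=> 0) ?Ex_cst//; apply/funext => w.
have -> : vsum X (amin m 0) w = 0.
  by apply: big1 => k _; rewrite /amin minn0 mulr0 scale0r.
by rewrite /nsq big1 ?powR0 ?gt_eqF ?divr_gt0// => i _; rewrite mxE expr0n.
Qed.

(** [powSS] and [powS] both come from the tangent of [r^p] at [i + 1]. They trade [p (i + 1)^(p-1)]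
    for an increment of the power, so that the steps telescope; the increments before and after
    [i + 1] account for the [.-1] and [.+1] in the two bounds below. *)
Let powSS i : p * i.+1%:R `^ (p - 1) <= i.+2%:R `^ p - i.+1%:R `^ p.
Proof.
have := powR_tangent p1 (ltr0Sn R i) (ler0n R i.+2).
rewrite (_ : i.+2%:R - i.+1%:R = 1) ?mulr1; last by rewrite -natrB// subSnn.
by lra.
Qed.

Let powS i : i.+1%:R `^ p - i%:R `^ p <= p * i.+1%:R `^ (p - 1).
Proof.
have := powR_tangent p1 (ltr0Sn R i) (ler0n R i).
rewrite (_ : i%:R - i.+1%:R = -1); last by rewrite -opprB -natrB// subSnn.
by lra.
Qed.

Let pd2 : 2 <= p -> 0 <= p + d%:R - 4.
Proof.
by move=> p2; have : 2 <= d%:R :> R by [rewrite ler_nat]; lra.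
Qed.

(* Raising the cut-off [i] in [a * min(m, i)] by one changes only the coordinates
   with [m k > i]; their derivatives are compared, by monotonicity in the other
   coordinates, with the derivatives at a multiple of [a]. *)
Lemma moment_natmul_le (m : 'I_n -> nat) : 2 <= p ->
  moment (fun k => a k * (m k)%:R) <= \sum_k weight k * (m k).+1%:R `^ p.
Proof.
move=> p2.
suff H i : moment (amin m i) <= \sum_k weight k * (minn (m k) i).+1%:R `^ p.
  rewrite -amin_max (le_trans (H _))//; apply: ler_sum => k _.
  by rewrite (minn_idPl _)// leq_bigmax.
elim: i => [|i ih].
  by rewrite moment0 sumr_ge0// => k _; rewrite mulr_ge0 ?weight_ge0 ?powR_ge0.
(* The tangent is taken at the end of the step, which bounds the increment of [moment] from
   above. *)
have := moment_tangent P bX X1 (amin m i.+1) (amin m i) p1.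
rewrite -lerBrDr => /le_trans; apply; rewrite -mulrN -sumrN mulr_sumr.
apply: (le_trans (lerD ih (lexx _))); rewrite -big_split/=.
apply: ler_sum => k _; rewrite -mulNr opprB aminS.
case: ifPn => [im|]; last first.
  by rewrite -leqNgt => mi; rewrite !(minn_idPl _) ?(leqW mi)// mul0r mulr0 addr0.
rewrite !(minn_idPr _) ?(ltnW im)//.
suff : a k * dmoment k (amin m i.+1) <= i.+1%:R `^ (p - 1) * weight k.
  move=> h; have := weight_ge0 k; have := powSS i.
  by have := ler_wpM2l p_ge0 h; nra.
have [->|ak] := eqVneq (a k) 0; first by rewrite mul0r /weight mulr_ge0 ?powR_ge0 ?weight_ge0.
have {}ak : 0 < a k by rewrite lt_neqAle eq_sym ak a0.
rewrite /weight mulrCA ler_wpM2l//.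
rewrite -dmomentZ// -[leLHS]mul1r -[leRHS]mul1r.
apply: dmoment_mono => //; [by rewrite mul1r subr_ge0|exact: pd2|..].
- by move=> j; rewrite amin_ge0 amin_le.
- by rewrite /amin (minn_idPr _)// mulrC.
- by rewrite /amin (minn_idPr _)// mulr_gt0.
Qed.

Lemma moment_natmul_ge (m : 'I_n -> nat) : p <= 2 -> 0 <= p + d%:R - 4 ->
  \sum_k weight k * (m k).-1%:R `^ p <= moment (fun k => a k * (m k)%:R).
Proof.
move=> p2 pd.
suff H i : \sum_k weight k * (minn (m k) i).-1%:R `^ p <= moment (amin m i).
  rewrite -amin_max (le_trans _ (H _))//; apply: ler_sum => k _.
  by rewrite (minn_idPl _)// leq_bigmax.
elim: i => [|i ih].
  by rewrite moment0 big1// => k _; rewrite minn0 powR0 ?mulr0// gt_eqF.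
(* The tangent is now taken at the start of the step, which bounds the increment from below. *)
apply: (le_trans _ (moment_tangent P bX X1 (amin m i) (amin m i.+1) p1)).
apply: (le_trans _ (lerD ih (lexx _))).
rewrite mulr_sumr -big_split/=; apply: ler_sum => k _; rewrite aminS.
case: ifPn => [im|]; last first.
  by rewrite -leqNgt => mi; rewrite !(minn_idPl _) ?(leqW mi)// mul0r mulr0 addr0.
rewrite !(minn_idPr _) ?(ltnW im)//=.
(* The first step starts at 0, where [dmoment_mono] does not apply. Because of the [.-1] both powers
   are 0 there, and a nonnegative increment suffices. *)
case: i im {ih} => [|i] im /=.
  rewrite lerDl mulr_ge0// mulr_ge0// dmoment_ge0//.
suff : i.+1%:R `^ (p - 1) * weight k <= a k * dmoment k (amin m i.+1).
  by move=> h; have := weight_ge0 k; have := powS i; have := ler_wpM2l p_ge0 h; nra.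
have [ak0|ak] := eqVneq (a k) 0; first by rewrite /weight ak0 !mul0r mulr0.
have {}ak : 0 < a k by rewrite lt_neqAle eq_sym ak a0.
rewrite /weight mulrCA ler_wpM2l//.
rewrite -dmomentZ// -[leLHS]opprK -[leRHS]opprK lerN2 -mulN1r -[leRHS]mulN1r.
apply: dmoment_mono => //; first by rewrite mulN1r oppr_ge0 subr_le0.
- by move=> j; rewrite amin_ge0 amin_le.
- by rewrite /amin (minn_idPr _) ?(ltnW im)// mulrC.
- by rewrite /amin (minn_idPr _) ?(ltnW im)// mulr_gt0.
Qed.

Let cvg_sum_weight (u : nat -> 'I_n -> R) (l : 'I_n -> R) :
  (forall N k, 0 <= u N k) -> (forall k, u N k @[N --> \oo] --> l k) ->
  \sum_k weight k * u N k `^ p @[N --> \oo] --> \sum_k weight k * l k `^ p.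
Proof.
move=> u0 ul; apply: (@cvg_big _ _ +%R) => [|k _]; first exact: add_continuous.
apply: cvgM; first exact: cvg_cst.
exact: powR_cvg.
Qed.

Let harm0 : 2 * N.+1%:R^-1 @[N --> \oo] --> (0 : R).
Proof.
rewrite -[X in _ --> X](mulr0 2); apply: cvgM; first exact: cvg_cst.
exact: cvg_harmonic.
Qed.

Lemma moment_tangent_le (l : 'I_n -> R) : 2 <= p -> (forall k, 0 <= l k) ->
  moment (fun k => a k * l k) <= \sum_k weight k * l k `^ p.
Proof.
(* Two mesh steps of margin: one for rounding [l k] up to [(m k).+1], one for the [.+1] of
   [moment_natmul_le]. *)
move=> p2 l0; pose u N k := l k + 2 * N.+1%:R^-1.
have cu : \sum_k weight k * u N k `^ p @[N --> \oo] --> \sum_k weight k * l k `^ p.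
  apply: cvg_sum_weight => [N k|k]; first by rewrite addr_ge0.
  by rewrite -[X in _ --> X]addr0; apply: cvgD => //; exact: cvg_cst.
apply: (cvgr_to_ge cu); apply: nearW => N.
have N0 : 0 < N.+1%:R :> R by [].
pose m k := Num.truncn (N.+1%:R * l k).
have mE k : (m k)%:R <= N.+1%:R * l k < (m k).+1%:R.
  by apply: truncn_itv; rewrite mulr_ge0.
apply: (@le_trans _ _ (moment (fun k => N.+1%:R^-1 * (a k * (m k).+1%:R)))).
  apply: moment_mono => // k; rewrite mulr_ge0//= mulrCA ler_wpM2l//.
  by rewrite ler_pdivlMl// ltW//; case/andP: (mE k).
rewrite momentZ//.
apply: (le_trans (ler_wpM2l (powR_ge0 _ _) (moment_natmul_le (fun k => (m k).+1) p2))).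
rewrite mulr_sumr; apply: ler_sum => k _; rewrite mulrCA ler_wpM2l ?weight_ge0//.
rewrite -powRM ?ler0n ?invr_ge0//.
apply: ge0_ler_powR; rewrite ?nnegrE//; first by rewrite addr_ge0.
have [mk _] := andP (mE k).
rewrite ler_pdivrMl// mulrDr mulrCA divff ?gt_eqF// mulr1.
by rewrite -2!natr1; lra.
Qed.

Lemma moment_tangent_ge (l : 'I_n -> R) : p <= 2 -> 0 <= p + d%:R - 4 ->
  (forall k, 0 <= l k) ->
  \sum_k weight k * l k `^ p <= moment (fun k => a k * l k).
Proof.
(* Two mesh steps are lost, by rounding down and by the [.-1] of [moment_natmul_ge]; the maximum
   keeps the base of the power nonnegative. *)
move=> p2 pd l0; pose u N k := Num.max (l k - 2 * N.+1%:R^-1) 0.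
have cu : \sum_k weight k * u N k `^ p @[N --> \oo] --> \sum_k weight k * l k `^ p.
  apply: cvg_sum_weight => [N k|k]; first by rewrite le_max lexx orbT.
  have cl : l k - 2 * N.+1%:R^-1 @[N --> \oo] --> l k.
    by rewrite -[X in _ --> X]subr0; apply: cvgB => //; exact: cvg_cst.
  apply: (squeeze_cvgr _ cl (cvg_cst (l k))); apply: nearW => N.
  by rewrite le_max lexx/= ge_max l0 andbT gerBl.
apply: (cvgr_to_le cu); apply: nearW => N.
have N0 : 0 < N.+1%:R :> R by [].
pose m k := Num.truncn (N.+1%:R * l k).
have mE k : (m k)%:R <= N.+1%:R * l k < (m k).+1%:R.
  by apply: truncn_itv; rewrite mulr_ge0.
apply: (@le_trans _ _ (moment (fun k => N.+1%:R^-1 * (a k * (m k)%:R)))); last first.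
  apply: moment_mono => // k; rewrite !mulr_ge0//= mulrCA ler_wpM2l//.
  by rewrite ler_pdivrMl//; case/andP: (mE k).
rewrite momentZ//.
apply: (le_trans _ (ler_wpM2l (powR_ge0 _ _) (moment_natmul_ge m p2 pd))).
rewrite mulr_sumr; apply: ler_sum => k _; rewrite [leRHS]mulrCA ler_wpM2l ?weight_ge0//.
rewrite -powRM ?ler0n ?invr_ge0//.
apply: ge0_ler_powR; rewrite ?nnegrE//; first by rewrite le_max lexx orbT.

rewrite ge_max mulr_ge0 ?ler0n// andbT.
have [_ mk] := andP (mE k).
rewrite ler_pdivlMl// mulrBr mulrCA divff ?gt_eqF// mulr1.
have : (m k).+1%:R - 2 <= (m k).-1%:R :> R.
  case: (m k) => [|j] /=; first by lra.
  by rewrite -2!natr1; lra.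
by lra.
Qed.

End tangent.

(** * Joint laws and independent uniform vectors *)

Section laws.
Context {R : realType} {dO dT : measure_display} {Omega : measurableType dO}.
Variable P : probability Omega R.

Lemma Ex_same_law (T : measurableType dT) (F G : Omega -> T) (psi : T -> R) :
  measurable_fun setT F -> measurable_fun setT G -> measurable_fun setT psi ->
  bddm (fun w => psi (F w)) -> bddm (fun w => psi (G w)) ->
  (forall A, measurable A -> P (F @^-1` A) = P (G @^-1` A)) ->
  Ex P (fun w => psi (F w)) = Ex P (fun w => psi (G w)).
Proof.
move=> mF mG mpsi bF bG FG.
pose F' : {mfun Omega >-> T} := HB.pack F (isMeasurableFun.Build _ _ _ _ _ mF).
pose G' : {mfun Omega >-> T} := HB.pack G (isMeasurableFun.Build _ _ _ _ _ mG).
have mpsi' : measurable_fun setT (EFin \o psi) by exact/measurable_EFinP.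
have E (H : {mfun Omega >-> T}) : bddm (fun w => psi (H w)) ->
    (\int[pushforward P H]_y (psi y)%:E = \int[P]_w (psi (H w))%:E)%E.
  move=> bH; rewrite integral_pushforward//; last exact: (bddm_integrable P bH).
congr fine; rewrite -(E F')// -(E G')//.
apply: eq_measure_integral => A mA _; exact: FG.
Qed.

Lemma measurable_box n (T : measurableType dT) (F : 'I_n -> Omega -> T) (A : 'I_n -> set T) :
  (forall i, measurable_fun setT (F i)) -> (forall i, measurable (A i)) ->
  measurable [set w | forall i, A i (F i w)].
Proof.
move=> mF mA.
have -> : [set w | forall i, A i (F i w)] = \big[setI/setT]_(i < n) (F i @^-1` A i).
  rewrite -bigcap_seq/=.
  by apply/seteqP; split => [w h i _|w h i]; [exact: h | apply: (h i); rewrite /= mem_index_enum].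
apply: bigsetI_measurable => i _.
by rewrite -[X in measurable X]setTI; exact: mF.
Qed.

Lemma measure_ae_eq (A B : set Omega) : measurable A -> measurable B ->
  {ae P, forall w, A w <-> B w} -> P A = P B.
Proof.
move=> mA mB AB.
have E C : measurable C -> P C = (\int[P]_w (\1_C w)%:E)%E.
  by move=> mC; rewrite integral_indic// setIT.
rewrite !E//; apply: ae_eq_integral => //.
- by apply/measurable_EFinP; exact: measurable_indic.
- by apply/measurable_EFinP; exact: measurable_indic.
apply: filterS AB => w AB _; rewrite /indic; congr (_%:R%:E).
by congr nat_of_bool; apply/idP/idP; rewrite !inE => /AB.
Qed.

(** Boxes are stable under intersection and generate the product sigma-algebra, so two probability
    laws that agree on them are equal. *)
Lemma tuple_law_unique n (T : measurableType dT) (F G : Omega -> n.-tuple T) :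
  measurable_fun setT F -> measurable_fun setT G ->
  (forall A : 'I_n -> set T, (forall i, measurable (A i)) ->
    P [set w | forall i, A i (tnth (F w) i)] = P [set w | forall i, A i (tnth (G w) i)]) ->
  forall B, measurable B -> P (F @^-1` B) = P (G @^-1` B).
Proof.
move=> mF mG FG.
pose F' : {mfun Omega >-> n.-tuple T} := HB.pack F (isMeasurableFun.Build _ _ _ _ _ mF).
pose G' : {mfun Omega >-> n.-tuple T} := HB.pack G (isMeasurableFun.Build _ _ _ _ _ mG).
pose box := [set B : set (n.-tuple T) | exists2 A : 'I_n -> set T,
  (forall i, measurable (A i)) & B = [set t | forall i, A i (tnth t i)] ].
have boxT : box setT by exists (fun=> setT) => //; apply/seteqP; split.
have mbox B : box B -> measurable B.
  move=> [A mA ->].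
  have -> : [set t | forall i, A i (tnth t i)] =
      \big[setI/setT]_(i < n) ((fun t : n.-tuple T => tnth t i) @^-1` A i).
    rewrite -bigcap_seq/=; apply/seteqP; split => [t h i _|t h i]; first exact: h.
    by apply: (h i); rewrite /= mem_index_enum.
  apply: bigsetI_measurable => i _.
  by rewrite -[X in measurable X]setTI; exact: measurable_tnth.
apply: (measure_unique box (fun=> setT) _ _ _ _ (distribution P F') (distribution P G')) => //.
- apply/seteqP; split; last first.
    by apply: smallest_sub; [exact: sigma_algebra_measurable | exact: mbox].
  apply: smallest_sub; first exact: smallest_sigma_algebra.
  rewrite -bigcup_seq/=; apply: bigcup_sub => i _ B [C mC <-].
  apply: sub_sigma_algebra; exists (fun j => if j == i then C else setT).
    by move=> j; case: ifP.
  rewrite setTI; apply/seteqP; split => [t /= tC j|t /= /(_ i)]; last by rewrite eqxx.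
  by case: eqP => // ->.
- move=> B1 B2 [A1 mA1 ->] [A2 mA2 ->]; exists (fun i => A1 i `&` A2 i).
    by move=> i; exact: measurableI.
  apply/seteqP; split => [t [h1 h2] i //|t h]; split=> i; by have [] := h i.
- by apply/seteqP; split => // t _; exists 0%N.
- by move=> B [A mA ->]; exact: FG.
- by move=> k; rewrite (le_lt_trans (probability_le1 _ measurableT))// ltry.
Qed.
End laws.

Section uniform_family.
Context {R : realType} {d : nat} {dO : measure_display} {Omega : measurableType dO}.
Variable P : probability Omega R.
Variable xi : nat -> {RV P >-> 'rV[R]_d}.
Hypothesis hd : (1 < d)%N.
Hypothesis xi_indep : mutually_independent P xi.
Hypothesis xi_unif : forall k, uniform_on_sphere (distribution P (xi k)).

Lemma enorm_eq1 (x : 'rV[R]_d) : (enorm x = 1) <-> (nsq x = 1).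
Proof.
split => [x1|x1]; last by rewrite /enorm -/(nsq x) x1 sqrtr1.
by rewrite -[LHS]sqr_sqrtr ?nsq_ge0// -[Num.sqrt _]/(enorm x) x1 expr1n.
Qed.

(* [xi k], redefined outside the almost sure event that it lies on the sphere. *)
Definition sph (k : nat) (w : Omega) : 'rV[R]_d :=
  if nsq (xi k w) == 1 then xi k w else delta_mx ord0 (Ordinal (ltnW hd)).

Lemma nsq_sph k w : nsq (sph k w) = 1.
Proof.
rewrite /sph; case: eqP => // _; rewrite /nsq (bigD1 (Ordinal (ltnW hd)))//=.
rewrite mxE !eqxx expr1n big1 ?addr0// => i ii.
by rewrite mxE (negPf ii) andbF expr0n.
Qed.

Let mxi k i : measurable_fun setT (fun w => xi k w ord0 i).
Proof. exact: (measurableT_comp (measurable_coord i) (measurable_funPT (xi k))). Qed.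

Let msphere k : measurable [set w | nsq (xi k w) = 1].
Proof.
have := measurable_nsq (mxi k) measurableT (measurable_set1 (1 : R)).
by rewrite setTI.
Qed.

Lemma sph_ae k : {ae P, forall w, sph k w = xi k w}.
Proof.
exists (~` [set w | nsq (xi k w) = 1]); split; first exact: measurableC.
  rewrite probability_setC//; have [h _] := xi_unif k.
  rewrite (_ : P [set w | nsq (xi k w) = 1] = 1%E) ?subee//.
  rewrite -h /distribution /pushforward; congr (P _).
  by apply/seteqP; split => w /= /enorm_eq1.
by move=> w /=; apply: contra_not => /eqP h; rewrite /sph h.
Qed.

Lemma sph_ae_all : {ae P, forall w, forall k, sph k w = xi k w}.
Proof. by apply: ae_foralln => k; exact: sph_ae. Qed.

Lemma bddv_sph k : bddv (sph k).
Proof.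
move=> i; split.
  have -> : (fun w => sph k w ord0 i) = (fun w => if nsq (xi k w) == 1 then
      xi k w ord0 i else (delta_mx ord0 (Ordinal (ltnW hd)) : 'rV[R]_d) ord0 i).
    by apply/funext => w; rewrite /sph; case: ifP.
  apply: measurable_fun_ifT; [|exact: mxi|exact: measurable_cst].
  exact: (measurable_fun_eqr (measurable_nsq (mxi k)) (measurable_cst _)).
exists 1 => w; rewrite -(@ler_pXn2r _ 2)// ?nnegrE// expr1n real_normK ?num_real//.
rewrite -(nsq_sph k w) /nsq (bigD1 i)//= lerDl.
by apply: sumr_ge0 => j _; exact: sqr_ge0.
Qed.

Let msph k : measurable_fun setT (sph k).
Proof. by apply: measurable_rVP => i; exact: (bddv_sph k i).1. Qed.

Section finite_family.
Variable n : nat.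

(** Independence is stated for a sequence, so [insub] extends the sets by the whole space outside
    the indices below [n]. Passing between [xi] and [sph] changes the event only on a null set. *)
Lemma sph_box (A : 'I_n -> set 'rV[R]_d) : (forall i, measurable (A i)) ->
  P [set w | forall i : 'I_n, A i (sph i w)] =
  (\prod_(k <- [fset k in iota 0 n]%fset) P (xi k @^-1` oapp A setT (insub k)))%E.
Proof.
move=> mA; rewrite -xi_indep; last first.
  by move=> k; case: insubP => [i _ _|_] /=; [exact: mA | exact: measurableT].
have -> : \bigcap_(k in [set` [fset k in iota 0 n]%fset])
    (xi k @^-1` oapp A setT (insub k)) = [set w | forall i : 'I_n, A i (xi i w)].
  apply/seteqP; split => [w h i|w h k /=].
    have := h i; rewrite /= insubT//= => ltin.
    rewrite (_ : Sub _ _ = i); last exact/val_inj.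
    by apply; rewrite !inE mem_iota.
  by rewrite !inE mem_iota add0n/= => kn; rewrite insubT/=; exact: (h (Ordinal kn)).
apply: measure_ae_eq.
- by apply: measurable_box => // i; exact: msph.
- by apply: measurable_box => // i; exact: measurable_funPT.
- by apply: filterS sph_ae_all => w h; split => + i => /(_ i); rewrite h.
Qed.

(** Rotating the member [k] keeps the joint law of the family: the probability of a box is a product
    in which only the factor [k] changes, and that factor is invariant by uniformity. The integrand
    is then a function of the whole tuple. *)
Lemma sph_rotinv (k : 'I_n) (b : 'I_n -> R) :
  rotinv P (fun w => \sum_(i | i != k) b i *: sph i w) (sph k).
Proof.
move=> O OO psi mpsi b1 b2.
have mO : measurable_fun setT (fun x : 'rV[R]_d => x *m O).
  apply: measurable_rVP => i; under eq_fun do rewrite mxE.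
  apply: measurable_sum => j; apply: measurable_funM; last exact: measurable_cst.
  exact: measurable_coord.
have msO : measurable_fun setT (fun w => sph k w *m O).
  exact: (measurableT_comp mO (msph k)).
pose F w := [tuple sph i w | i < n].
pose G w := [tuple (if i == k then sph k w *m O else sph i w) | i < n].
have mF : measurable_fun setT F.
  apply/measurable_fun_tnthP => i; rewrite (_ : _ \o _ = sph i)//.
  by apply/funext => w /=; rewrite tnth_mktuple.
have mG : measurable_fun setT G.
  apply/measurable_fun_tnthP => i.
  rewrite (_ : _ \o _ = if i == k then (fun w => sph k w *m O) else sph i).
    by case: eqP.
  by apply/funext => w /=; rewrite tnth_mktuple; case: eqP.
pose Psi (t : n.-tuple 'rV[R]_d) := psi (\sum_(i | i != k) b i *: tnth t i, tnth t k).
have FE w : psi (\sum_(i | i != k) b i *: sph i w, sph k w) = Psi (F w).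
  rewrite /Psi tnth_mktuple; congr (psi (_, _)); apply: eq_bigr => i _.
  by rewrite tnth_mktuple.
have GE w : psi (\sum_(i | i != k) b i *: sph i w, sph k w *m O) = Psi (G w).
  rewrite /Psi tnth_mktuple eqxx; congr (psi (_, _)); apply: eq_bigr => i /negPf ik.
  by rewrite tnth_mktuple ik.
have e1 := funext FE; have e2 := funext GE.
have b1' : bddm (fun w => Psi (F w)) by rewrite -e1; exact: b1.
have b2' : bddm (fun w => Psi (G w)) by rewrite -e2; exact: b2.
transitivity (Ex P (fun w => Psi (F w))); first by rewrite -e1.
transitivity (Ex P (fun w => Psi (G w))); last by rewrite -e2.
apply: Ex_same_law => //.
- apply: (measurableT_comp mpsi); apply: measurable_fun_pair; last exact: measurable_tnth.
  apply: measurable_rVP => j; under eq_fun do rewrite summxE big_mkcond.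
  apply: measurable_sum => i; case: (i != k); last exact: measurable_cst.
  under eq_fun do rewrite mxE.
  apply: measurable_funM; first exact: measurable_cst.
  exact: (measurableT_comp (measurable_coord j) (measurable_tnth i)).
- apply: tuple_law_unique => // A mA.
  have -> : [set w | forall i, A i (tnth (F w) i)] = [set w | forall i : 'I_n, A i (sph i w)].
    by apply/seteqP; split => w /= h i; have := h i; rewrite tnth_mktuple.
  pose A' i := if i == k then (fun x : 'rV[R]_d => x *m O) @^-1` A k else A i.
  have mA' i : measurable (A' i).
    rewrite /A'; case: ifP => // _.
    by rewrite -[X in measurable X]setTI; exact: mO.
  have -> : [set w | forall i, A i (tnth (G w) i)] = [set w | forall i : 'I_n, A' i (sph i w)].
    apply/seteqP; split => w /= h i; have := h i; rewrite tnth_mktuple /A';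
    by case: eqP => // ->.
  rewrite !sph_box//; apply: eq_bigr => j _; case: insubP => //= i _ ij.
  rewrite /A'; case: eqP => // ik; rewrite -ik.
  by have [_ /(_ O OO (A i) (mA i))] := xi_unif j.
Qed.

End finite_family.
End uniform_family.

(** * Powers of Euclidean and Lp norms *)

Section enorm_powers.
Context {R : realType} {d : nat}.

Lemma enorm_pow (x : 'rV[R]_d) p : enorm x `^ p = nsq x `^ (p / 2).
Proof. by rewrite /enorm -/(nsq x) -powR12_sqrt ?nsq_ge0// -powRrM mulrC. Qed.

(** A crude bound for fixed vectors; it serves to show that the vector-valued function has a finite
    norm. *)
Lemma nsq_lincomb_pow_le n (v : 'I_n -> 'rV[R]_d) p : 1 <= p -> exists2 K, 0 <= K &
  forall b : 'I_n -> R,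
    nsq (\sum_k b k *: v k) `^ (p / 2) <= K * \sum_k `|b k| `^ p.
Proof.
move=> p1; case: n v => [|n] v.
  have p2 : p / 2 != 0 by rewrite gt_eqF//; lra.
  exists 0 => // b; rewrite !big_ord0 mulr0 /nsq big1 ?powR0// => i _.
  by rewrite mxE expr0n.
pose V := \sum_k \sum_i `|v k ord0 i|.
have V0 : 0 <= V by apply: sumr_ge0 => k _; exact: sumr_ge0.
pose D := d%:R * V ^+ 2; have D0 : 0 <= D by rewrite mulr_ge0// sqr_ge0.
exists (D `^ (p / 2) * n.+1%:R `^ p) => [|b]; first by rewrite mulr_ge0 ?powR_ge0.
pose B := \sum_k `|b k|; have B0 : 0 <= B by exact: sumr_ge0.
have le1 : nsq (\sum_k b k *: v k) <= D * B ^+ 2.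
  have -> : D * B ^+ 2 = \sum_(i < d) (V * B) ^+ 2.
    by rewrite sumr_const card_ord -[RHS]mulr_natl exprMn /D -mulrA.
  apply: ler_sum => i _; rewrite -real_normK ?num_real// lerXn2r// ?nnegrE ?mulr_ge0//.
  rewrite summxE (le_trans (ler_norm_sum _ _ _))// mulr_sumr; apply: ler_sum => k _.
  rewrite mxE normrM mulrC ler_wpM2r// /V (bigD1 k)//= (bigD1 i)//=.
  rewrite -addrA lerDl addr_ge0//; last by apply: sumr_ge0 => j _; exact: sumr_ge0.
  exact: sumr_ge0.
(* Some term is at least the average, so the power of the sum reduces to the power of one term. *)
have [k Bk] : exists k, B <= n.+1%:R * `|b k|.
  apply/not_existsP => h.
  suff : n.+1%:R * B < n.+1%:R * B by rewrite ltxx.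
  have e1 : n.+1%:R * B = \sum_k n.+1%:R * `|b k| by rewrite mulr_sumr.
  have e2 : n.+1%:R * B = \sum_(k < n.+1) B by rewrite sumr_const card_ord mulr_natl.
  rewrite {1}e1 e2.
  apply: ltr_sum; first by apply/hasP; exists ord0 => //; exact: mem_index_enum.
  by move=> k _; rewrite ltNge; apply/negP; exact: h.
have p0 : 0 <= p by lra.
apply: (@le_trans _ _ ((D * B ^+ 2) `^ (p / 2))).
  by apply: ge0_ler_powR; rewrite ?nnegrE ?nsq_ge0 ?mulr_ge0 ?sqr_ge0//; lra.
rewrite powRM ?sqr_ge0// -mulrA ler_wpM2l ?powR_ge0//.
rewrite -powR_mulrn// -powRrM (_ : 2 * (p / 2) = p); last by field.
apply: (@le_trans _ _ ((n.+1%:R * `|b k|) `^ p)).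
  by apply: ge0_ler_powR; rewrite ?nnegrE ?mulr_ge0.
rewrite powRM// ler_wpM2l ?powR_ge0// (bigD1 k)//= lerDl.
by apply: sumr_ge0 => j _; exact: powR_ge0.
Qed.
End enorm_powers.

Section Lp_norm_powers.
Local Open Scope ereal_scope.
Context {R : realType} {dT : measure_display} {T : measurableType dT}.
Variable mu : {measure set T -> \bar R}.

(** Infinite norms are covered too: [fine] then sends both the norm and the integral to 0. *)
Lemma fine_Lnorm_pow (p : R) (g : T -> R) : (0 < p)%R ->
  (fine 'N[mu]_p%:E[EFin \o g] `^ p)%R = fine (\int[mu]_t (`|g t| `^ p)%:E).
Proof.
move=> p0; have pn : p != 0%R by rewrite gt_eqF.
have -> : \int[mu]_t (`|g t| `^ p)%:E = 'N[mu]_p%:E[EFin \o g] `^ p.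
  by rewrite powR_Lnorm//; apply: eq_integral => t _.
have := Lnorm_ge0 mu p%:E (EFin \o g).
case: ('N[mu]_p%:E[EFin \o g]) => [r _||//]; first by rewrite poweR_EFin.
by rewrite poweRyr//= powR0.
Qed.

Lemma integral_pow_Lfun (p : R) (g : T -> R) : (0 < p)%R -> g \in Lfun mu p%:E ->
  \int[mu]_t (`|g t| `^ p)%:E = (fine 'N[mu]_p%:E[EFin \o g] `^ p)%:E.
Proof.
move=> p0 /sub_Lfun_finLfun; rewrite inE /= => fin.
rewrite -poweR_EFin fineK; last by rewrite ge0_fin_numE// Lnorm_ge0.
by rewrite powR_Lnorm ?gt_eqF.
Qed.

End Lp_norm_powers.

(** * Integration of the tangent inequality *)

Section vector_khintchine.
Context {R : realType} {d n : nat} {dO : measure_display} {Omega : measurableType dO}.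
Variable P : probability Omega R.
Variable xi : nat -> {RV P >-> 'rV[R]_d}.
Hypothesis hd : (1 < d)%N.
Hypothesis xi_indep : mutually_independent P xi.
Hypothesis xi_unif : forall k, uniform_on_sphere (distribution P (xi k)).
Context {dT : measure_display} {T : measurableType dT}.
Variable mu : {sigma_finite_measure set T -> \bar R}.
Variables (p : R) (f : 'I_n -> T -> R).
Hypotheses (p1 : 1 <= p) (fL : forall k, f k \in Lfun mu p%:E).

Let p_gt0 : 0 < p. Proof. by apply: lt_le_trans p1. Qed.
Let p_ge0 : 0 <= p. Proof. exact: ltW. Qed.
Let a k := fine ('N[mu]_p%:E[EFin \o f k])%E.
Let a_ge0 k : 0 <= a k. Proof. by rewrite fine_ge0// Lnorm_ge0. Qed.
Let X (k : 'I_n) := sph xi hd k.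
Let bX k : bddv (X k). Proof. exact: bddv_sph. Qed.
Let X1 k w : nsq (X k w) = 1. Proof. exact: nsq_sph. Qed.
Let rotX k b : rotinv P (fun w => \sum_(i | i != k) b i *: X i w) (X k).
Proof. exact: sph_rotinv. Qed.
Let mf k : measurable_fun setT (f k).
Proof. by have := sub_Lfun_mfun (fL k); rewrite inE. Qed.
Let mxi k i : measurable_fun setT (fun w => xi k w ord0 i).
Proof. exact: (measurableT_comp (measurable_coord i) (measurable_funPT (xi k))). Qed.

Lemma expectation_pow_moment (b : 'I_n -> R) :
  (\int[P]_w (enorm (\sum_(k < n) b k *: xi k w) `^ p)%:E = (moment P X p b)%:E)%E.
Proof.
have bM : bddm (fun w => nsq (vsum X b w) `^ (p / 2)).
  have bS : bddv (vsum X b) by apply: bddv_sum => k; exact: bddvZ.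
  split; first exact: (measurableT_comp (measurable_powR _) (bddm_nsq bS).1).
  have [_ [M hM]] := bddm_nsq bS; exists (M `^ (p / 2)) => w.
  rewrite ger0_norm ?powR_ge0//.
  apply: ge0_ler_powR; rewrite ?nnegrE ?nsq_ge0//.
  - by rewrite divr_ge0.
  - by rewrite (le_trans _ (hM w)).
  - by rewrite (le_trans (ler_norm _) (hM w)).
rewrite /moment /Ex fineK; last exact: (integrable_fin_num measurableT (bddm_integrable P bM)).
apply: ae_eq_integral => //.
- apply/measurable_EFinP; under eq_fun do rewrite enorm_pow.
  apply: (measurableT_comp (measurable_powR _)); apply: measurable_nsq => i.
  under eq_fun do rewrite summxE.
  apply: measurable_sum => k; under eq_fun do rewrite mxE.
  by apply: measurable_funM => //; exact: mxi.
- by apply/measurable_EFinP; exact: bM.1.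
- apply: filterS (sph_ae_all hd xi_unif) => w h _; rewrite enorm_pow.
  by congr (nsq _ `^ _)%:E; apply: eq_bigr => k _; rewrite /X h.
Qed.

Let I w := (\int[mu]_t (enorm (\sum_(k < n) f k t *: xi k w) `^ p)%:E)%E.

(** Guarantees that the [fine] inside the norm does not replace an infinite integral by 0. *)
Let I_fin w : I w \is a fin_num.
Proof.
have [K K0 hK] := nsq_lincomb_pow_le (fun k : 'I_n => xi k w) p1.
rewrite ge0_fin_numE; last by apply: integral_ge0 => t _; rewrite lee_fin powR_ge0.
have mfp k : measurable_fun setT (fun t => (`|f k t| `^ p)%:E).
  apply/measurable_EFinP; apply: (measurableT_comp (measurable_powR _)).
  exact: measurableT_comp.
have mI : measurable_fun setT (fun t => (enorm (\sum_(k < n) f k t *: xi k w) `^ p)%:E).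
  apply/measurable_EFinP; under eq_fun do rewrite enorm_pow.
  apply: (measurableT_comp (measurable_powR _)); apply: measurable_nsq => i.
  under eq_fun do rewrite summxE.
  apply: measurable_sum => k; under eq_fun do rewrite mxE.
  by apply: measurable_funM.
apply: (@le_lt_trans _ _ (\int[mu]_t (K%:E * \sum_(k < n) (`|f k t| `^ p)%:E))%E).
  apply: ge0_le_integral => //.
  - by move=> t _; rewrite lee_fin powR_ge0.
  - by apply: emeasurable_funM => //; apply: emeasurable_sum.
  - by move=> t _; rewrite sumEFin -EFinM lee_fin enorm_pow.
rewrite ge0_integralZl//; last 2 first.
- by apply: emeasurable_sum.
- by move=> t _; apply: sume_ge0 => k _; rewrite lee_fin powR_ge0.
rewrite ge0_integral_sum//.
rewrite (eq_bigr _ (fun k _ => integral_pow_Lfun p_gt0 (fL k))).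
by rewrite sumEFin -EFinM ltry.
Qed.

Let mG : measurable_fun setT
  (fun z : Omega * T => (enorm (\sum_(k < n) f k z.2 *: xi k z.1) `^ p)%:E).
Proof.
apply/measurable_EFinP; under eq_fun do rewrite enorm_pow.
apply: (measurableT_comp (measurable_powR _)); apply: measurable_nsq => i.
under eq_fun do rewrite summxE.
apply: measurable_sum => k; under eq_fun do rewrite mxE.
apply: measurable_funM.
  exact: (measurableT_comp (mf k) measurable_snd).
exact: (measurableT_comp (mxi k i) measurable_fst).
Qed.

Let G_ge0 (z : Omega * T) :
  (0 <= (enorm (\sum_(k < n) f k z.2 *: xi k z.1) `^ p)%:E)%E.
Proof. by rewrite lee_fin powR_ge0. Qed.

(** Tonelli exchanges the expectation with the integral in [t]; for fixed [t] the numbers [f k t]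
    become coefficients of [moment]. *)
Lemma expectation_vnorm_pow :
  (\int[P]_w ((fine ('N[mu]_p%:E[EFin \o (fun t => enorm (\sum_(k < n) f k t *: xi k w))])
    `^ p)%R)%:E = \int[mu]_t (moment P X p (f ^~ t))%:E)%E.
Proof.
transitivity (\int[P]_w I w)%E.
  apply: eq_integral => w _; rewrite -[RHS](fineK (I_fin w)); congr (_%:E).
  rewrite (fine_Lnorm_pow mu (fun t => enorm (\sum_(k < n) f k t *: xi k w)) p_gt0).
  congr (fine _); apply: eq_integral => t _.
  by rewrite ger0_norm//; exact: sqrtr_ge0.
rewrite /I (fubini_tonelli _ mG G_ge0); apply: eq_integral => t _.
exact: (expectation_pow_moment (f ^~ t)).
Qed.

Lemma measurable_moment : measurable_fun setT (fun t => (moment P X p (f ^~ t))%:E).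
Proof.
have E := funext (fun t => expectation_pow_moment (f ^~ t)).
by rewrite -E; exact: (measurable_fun_fubini_tonelli_G (m1 := P) _ mG G_ge0).
Qed.

(** If [a k = 0] the quotient is 0 by convention, which agrees with [f k] vanishing almost
    everywhere. *)
Let l k t := `|f k t| / a k.

Let moment_l : {ae mu, forall t, moment P X p (f ^~ t) = moment P X p (fun k => a k * l k t)}.
Proof.
have H : {ae mu, forall t, forall k, `|f k t| = a k * l k t}.
  have Hk k : {ae mu, forall t, `|f k t| = a k * l k t}.
    have [a0|a0] := eqVneq (a k) 0; last by apply: aeW => t; rewrite /l; field.
    have N0 : ('N[mu]_p%:E[EFin \o f k] = 0)%E.
      have fin : ('N[mu]_p%:E[EFin \o f k])%E \is a fin_num.
        rewrite ge0_fin_numE ?Lnorm_ge0//.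
        by have := sub_Lfun_finLfun (fL k); rewrite inE.
      by rewrite -[LHS]fineK// -/(a k) a0.
    have mEf : measurable_fun setT (EFin \o f k) by exact/measurable_EFinP.
    have := Lnorm_eq0_eq0 mEf _ N0; rewrite lte_fin => /(_ p_gt0).
    apply: filterS => t /(_ Logic.I) /= [->].
    by rewrite normr0 a0 mul0r.
  pose g (m : nat) t := if insub m is Some k then `|f k t| = a k * l k t else True.
  have := @ae_foralln _ _ _ mu g.
  have hg m : \forall t \ae mu, g m t.
    by rewrite /g; case: insubP => [k _ _|_]; [exact: Hk | exact: aeW].
  by move=> /(_ hg); apply: filterS => t h k; have := h k; rewrite /g valK.
apply: filterS H => t h; rewrite -(funext h : (fun k => `|f k t|) = _).
exact: (esym (moment_abs bX rotX (f ^~ t) p_ge0)).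
Qed.

Let ml k : measurable_fun setT (fun t => l k t `^ p).
Proof.
apply: (measurableT_comp (measurable_powR _)); apply: measurable_funM => //.
exact: measurableT_comp.
Qed.

Let l_ge0 k t : 0 <= l k t. Proof. by rewrite divr_ge0. Qed.

(** Each [l k ^ p] has integral 1, except when [a k = 0], and then [weight k = 0]; the weights add
    up to [moment a]. *)
Let integral_l :
  (\int[mu]_t (\sum_k weight P X p a k * l k t `^ p)%:E = (moment P X p a)%:E)%E.
Proof.
have w0 k : 0 <= weight P X p a k by exact: weight_ge0.
under eq_integral do rewrite -sumEFin.
rewrite ge0_integral_sum//; last 2 first.
- by move=> k; apply/measurable_EFinP; apply: measurable_funM.
- by move=> k t _; rewrite lee_fin mulr_ge0 ?powR_ge0.
rewrite -(sum_weight P bX X1 a p1) -sumEFin; apply: eq_bigr => k _.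
under eq_integral do rewrite EFinM.
have mlk : measurable_fun setT (fun t => (l k t `^ p)%:E) by exact/measurable_EFinP.
have l0 t : setT t -> (0 <= (l k t `^ p)%:E)%E by move=> _; rewrite lee_fin powR_ge0.
rewrite (ge0_integralZl _ measurableT mlk l0) ?lee_fin//.
have [a0|a0] := eqVneq (a k) 0; first by rewrite /weight a0 mul0r mul0e.
have ak : 0 < a k by rewrite lt_neqAle eq_sym a0 a_ge0.
have -> : (\int[mu]_t (l k t `^ p)%:E = ((a k)^-1 `^ p)%:E * \int[mu]_t (`|f k t| `^ p)%:E)%E.
  have mfk : measurable_fun setT (fun t => (`|f k t| `^ p)%:E).
    apply/measurable_EFinP; apply: (measurableT_comp (measurable_powR _)).
    exact: measurableT_comp.
  have f0 t : setT t -> (0 <= (`|f k t| `^ p)%:E)%E by move=> _; rewrite lee_fin powR_ge0.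
  rewrite -(ge0_integralZl _ measurableT mfk f0) ?lee_fin ?powR_ge0//.
  by apply: eq_integral => t _; rewrite /l powRM ?invr_ge0// mulrC EFinM.
rewrite (integral_pow_Lfun p_gt0 (fL k)) -/(a k) -!EFinM -powRM ?invr_ge0//.
by rewrite mulVf// powR1 mulr1.
Qed.

Let m0 t : setT t -> (0 <= (moment P X p (f ^~ t))%:E)%E.
Proof. by move=> _; rewrite lee_fin; apply: Ex_ge0 => w; exact: powR_ge0. Qed.

Let s0 t : setT t -> (0 <= (\sum_k weight P X p a k * l k t `^ p)%:E)%E.
Proof.
move=> _; rewrite lee_fin; apply: sumr_ge0 => k _; apply: mulr_ge0; last exact: powR_ge0.
exact: weight_ge0.
Qed.

Let ms : measurable_fun setT (fun t => (\sum_k weight P X p a k * l k t `^ p)%:E).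
Proof.
by apply/measurable_EFinP; apply: measurable_sum => k; exact: measurable_funM.
Qed.

(** By [integral_l], [moment a] is the integral of its own tangent evaluated along [l], and for
    almost every [t] this tangent lies above [moment]. *)
Theorem integral_moment_le : 2 <= p ->
  (\int[mu]_t (moment P X p (f ^~ t))%:E <= (moment P X p a)%:E)%E.
Proof.
move=> p2; rewrite -[X in (_ <= X)%E]integral_l.
apply: (ae_ge0_le_integral measurableT m0 measurable_moment s0 ms).
apply: filterS moment_l => t mE _; rewrite mE lee_fin.
exact: (moment_tangent_le bX X1 rotX hd p1 a_ge0 p2 (l_ge0 ^~ t)).
Qed.

Theorem integral_moment_ge : p <= 2 -> 0 <= p + d%:R - 4 ->
  ((moment P X p a)%:E <= \int[mu]_t (moment P X p (f ^~ t))%:E)%E.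
Proof.
move=> p2 pd; rewrite -[X in (X <= _)%E]integral_l.
apply: (ae_ge0_le_integral measurableT s0 ms m0 measurable_moment).
apply: filterS moment_l => t mE _; rewrite mE lee_fin.
exact: (moment_tangent_ge bX X1 rotX hd p1 a_ge0 p2 pd (l_ge0 ^~ t)).
Qed.

End vector_khintchine.

Lemma lebesgue01_fin_num_fun (R : realType) : fin_num_fun (lebesgue01 R).
Proof.
move=> U mU; rewrite ge0_fin_numE ?measure_ge0//.
apply: (@le_lt_trans _ _ (lebesgue_measure (`[0, 1] : set R))%classic).
  by apply: le_measure; rewrite ?inE//; exact: measurableI.
by rewrite lebesgue_measure_itv/= lte_fin ltr01 oppr0 adde0 ltry.
Qed.

Theorem theorem1 (R : realType) (d : nat) (hd : (2 <= d)%N)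
    (dO : measure_display) (Omega : measurableType dO) (P : probability Omega R)
    (xi : nat -> {RV P >-> 'rV[R]_d})
    (xi_indep : mutually_independent P xi)
    (xi_unif : forall k, uniform_on_sphere (distribution P (xi k))) :
  (forall p : R, 2 <= p ->
    forall n : nat, (1 <= n)%N ->
    forall f : 'I_n -> R -> R, (forall k, Lp01 p (f k)) ->
      ('E_P[fun w => (Lp01_vnorm p (fun t => \sum_(k < n) f k t *: xi k w) `^ p)%R]
       <= 'E_P[fun w => (enorm (\sum_(k < n) Lp01_norm p (f k) *: xi k w) `^ p)%R])%E)
  /\
  ((3 <= d)%N -> forall p : R, 1 <= p -> p <= 2 ->
    forall n : nat, (1 <= n)%N ->
    forall f : 'I_n -> R -> R, (forall k, Lp01 p (f k)) ->
      ('E_P[fun w => (Lp01_vnorm p (fun t => \sum_(k < n) f k t *: xi k w) `^ p)%R]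
       >= 'E_P[fun w => (enorm (\sum_(k < n) Lp01_norm p (f k) *: xi k w) `^ p)%R])%E).
Proof.
(* The restricted Lebesgue measure is packed as a finite measure to provide the sigma-finiteness
   used by Tonelli. *)
pose mu : {finite_measure set (measurableTypeR R) -> \bar R} :=
  HB.pack (mrestr (@lebesgue_measure R) (measurable_itv `[0 : R, 1]))
    (Measure_isFinite.Build _ _ _ (mrestr (@lebesgue_measure R) (measurable_itv `[0 : R, 1]))
      (@lebesgue01_fin_num_fun R)).
split => [p p2|hd3 p p1 p2] n n1 f fL.
- have p1 : 1 <= p by apply: le_trans p2; rewrite ler1n.
  have p0 : 0 < p by apply: lt_le_trans p1.
  rewrite unlock.
  rewrite (expectation_vnorm_pow hd xi_unif (mu := mu) p1 fL).
  rewrite (expectation_pow_moment hd xi_unif p1).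
  exact: (integral_moment_le hd xi_indep xi_unif (mu := mu) p1 fL p2).
- have pd : 0 <= p + d%:R - 4.
    by have : 3 <= d%:R :> R by [rewrite ler_nat]; lra.
  rewrite unlock.
  rewrite (expectation_vnorm_pow hd xi_unif (mu := mu) p1 fL).
  rewrite (expectation_pow_moment hd xi_unif p1).
  exact: (integral_moment_ge hd xi_indep xi_unif (mu := mu) p1 fL p2 pd).
Qed.
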